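(* Let $(X,\mathcal B,\mu)$ be the probability space and $f:X\to X$ the odometer described in the context, and let $1\le p<\infty$. Then the composition operator $T_f:\varphi\mapsto\varphi\circ f$ on $L^p(X,\mathcal B,\mu)$ is topologically transitive.
   Context: Let $X=\prod_{i=1}^\infty A_i$, where $A_i=\{0,1\}$ if $i$ is even and $A_i=\{0,1,\ldots,2i-1\}$ if $i$ is odd. Each $A_i$ carries the discrete topology and the probability measure $\mu_i$ on $2^{A_i}$ given on atoms by: $\mu_i(0)=\mu_i(1)=\frac12$ if $i$ is even; and, if $i$ is odd, $\mu_i(j)=\frac{1-2^{-i}}{i}$ for $j\in\{0,\ldots,i-1\}$ and $\mu_i(j)=\frac{2^{-i}}{i}$ for $j\in\{i,\ldots,2i-1\}$. Let $\mathcal B$ be the product $\sigma$-algebra and $\mu$ the product measure of the $\mu_i$ on $X$. The odometer $f:X\to X$ is defined as follows. If $x^*=(\max A_i)_{i=1}^\infty$ then $f(x^* )=(0,0,0,\ldots)$. If $x=(x_i)\ne x^*$, let $\ell(x)=\min\{i\ge1: x_i<\max A_i\}$ and let $f(x)$ be the sequence with $f(x)_i=0$ for $i<\ell(x)$, $f(x)_i=x_i+1$ for $i=\ell(x)$, and $f(x)_i=x_i$ for $i>\ell(x)$. The map $f$ is a homeomorphism of $X$, and $T_f$ is a bounded linear operator on $L^p(X,\mathcal B,\mu)$. A bounded linear operator $T$ on a Banach space $\mathcal X$ is topologically transitive if for any nonempty open sets $U,V\subset\mathcal X$ there exists an integer $k\ge0$ such that $T^k(U)\cap V\ne\emptyset$.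 *)

(* Defs.v *)
From HB Require Import structures.
From mathcomp Require Import all_boot all_order all_algebra.
From mathcomp Require Import complex.
From mathcomp Require Import all_classical all_reals all_analysis.
From mathcomp Require Import measurable_realfun ess_sup_inf.
Set Implicit Arguments.
Unset Strict Implicit.
Unset Printing Implicit Defensive.
Import Order.TTheory GRing.Theory Num.Theory.
Import numFieldNormedType.Exports.
Local Open Scope classical_set_scope.
Local Open Scope ring_scope.

(* The library's [LspaceType] carries no algebraic or topological structure; it is
   made a normed space here, with operations taken on representatives. *)
Section Lspace_normed.
Context d (T : measurableType d) (R : realType).
Variables (mu : {measure set T -> \bar R}) (p : \bar R) (p1 : (1 <= p)%E).
Local Notation Lp := (LspaceType mu p1).
Local Notation Lf := (LfunType mu p1).

Lemma le_ae_Lnorm (f g : T -> R) :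
  measurable_fun setT f -> measurable_fun setT g ->
  (\forall x \ae mu, `|f x| <= `|g x|) ->
  ('N[mu]_p[EFin \o f] <= 'N[mu]_p[EFin \o g])%E.
Proof.
move=> mf mg fg; rewrite unlock /Lnorm.
case: p p1 => [r r1|_|//].
- have r0 : 0 <= r by rewrite (le_trans ler01).
  apply: gt0_ler_poweR; rewrite ?invr_ge0// ?in_itv/= ?leey ?andbT.
  + by apply: integral_ge0 => x _; rewrite lee_fin powR_ge0.
  + by apply: integral_ge0 => x _; rewrite lee_fin powR_ge0.
  apply: ae_ge0_le_integral => //.
  + apply: measurableT_comp => //.
    by apply: (measurableT_comp (measurable_powR _)); exact: measurableT_comp.
  + apply: measurableT_comp => //.
    by apply: (measurableT_comp (measurable_powR _)); exact: measurableT_comp.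
  + apply: filterS fg => x fgx _; rewrite /= lee_fin.
    by apply: ge0_ler_powR; rewrite ?nnegrE.
- case: ifP => // _; apply: le_ess_sup.
  by apply: filterS fg => x; rewrite /= lee_fin.
Qed.

Lemma eq_ae_Lnorm (f g : T -> R) :
  measurable_fun setT f -> measurable_fun setT g -> f = g %[ae mu] ->
  'N[mu]_p[EFin \o f]%E = 'N[mu]_p[EFin \o g]%E.
Proof.
move=> mf mg fg; apply/eqP; rewrite eq_le; apply/andP; split;
  by apply: le_ae_Lnorm => //; apply: filterS fg => x /= /(_ I) ->.
Qed.

HB.instance Definition _ := gen_eqMixin Lp.
HB.instance Definition _ := gen_choiceMixin Lp.

Lemma Lspace_eqP (u v : Lp) : (u : T -> R) = v %[ae mu] -> u = v.
Proof.
case: u v => [u [[cu]]] [v [[cv]]] /= uv.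
have e : u = v.
  by apply/eqP; rewrite -(reprK u) -(reprK v); exact/ae_eqP.
move: cu; rewrite e => cu; congr (LebesgueSpace.Pack (LebesgueSpace.Class _)).
by congr isFinLebesgue.Axioms_; exact: Prop_irrelevance.
Qed.

Lemma Lspace_measurable (u : Lp) : measurable_fun setT (u : T -> R).
Proof. exact: measurable_funPT (repr (LebesgueSpace.sort u)). Qed.


Lemma Lspace_Lnorm_lty (u : Lp) : finite_norm mu p (u : T -> R).
Proof. by case: u => u [[]]. Qed.

Lemma Lf_of_Lspace_proof (u : Lp) : (u : T -> R) \in Lfun mu p.
Proof.
by rewrite inE; apply/andP; split; apply/mem_set;
  [exact: Lspace_measurable|exact: Lspace_Lnorm_lty].
Qed.

Definition Lf_of_Lspace (u : Lp) : Lf := Lfun_Sub p1 (Lf_of_Lspace_proof u).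

(* The library's classes are over functions into [measurableTypeR R], a copy of
   [R] with the same sigma-algebra under another display. *)
Section mfunTypeR.
Variable f : Lf.
Definition fun_typeR : T -> measurableTypeR R := f.
Let mfun_typeR : measurable_fun setT fun_typeR.
Proof. exact: (measurable_funPT f). Qed.
HB.instance Definition _ := isMeasurableFun.Build _ _ _ _ fun_typeR mfun_typeR.
Definition Lspace_pi : {mfun_ mu, T >-> measurableTypeR R} :=
  (\pi_({mfun_ mu, T >-> measurableTypeR R})
    [the {mfun T >-> measurableTypeR R} of fun_typeR])%qT.
End mfunTypeR.

Lemma Lspace_piE (f : Lf) : (Lspace_pi f : T -> R) = f %[ae mu].
Proof.
rewrite /Lspace_pi /aqEqMfun_to_fun.
case: piP => g /eqP; rewrite eqmodE => /asboolP h.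
exact: ae_eq_sym.
Qed.

Lemma Lspace_of_Lf_proof (f : Lf) : finite_norm mu p (Lspace_pi f : T -> R).
Proof.
rewrite /finite_norm (eq_ae_Lnorm _ _ (Lspace_piE f))//.
  exact: Lfunction_finite.
exact: measurable_funPT (repr (Lspace_pi f)).
Qed.

Definition Lspace_of_Lf (f : Lf) : Lp :=
  @LebesgueSpace.Pack _ _ _ mu p p1 (Lspace_pi f)
    (LebesgueSpace.Class
      (isFinLebesgue.Build _ _ _ mu p p1 (Lspace_pi f) (Lspace_of_Lf_proof f))).

Lemma Lspace_of_LfE (f : Lf) : (Lspace_of_Lf f : T -> R) = f %[ae mu].
Proof. exact: Lspace_piE. Qed.

Definition Lspace_zero : Lp := Lspace_of_Lf 0.
Definition Lspace_opp (u : Lp) := Lspace_of_Lf (- Lf_of_Lspace u).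
Definition Lspace_add (u v : Lp) :=
  Lspace_of_Lf (Lf_of_Lspace u + Lf_of_Lspace v).
Definition Lspace_scale (a : R) (u : Lp) := Lspace_of_Lf (a *: Lf_of_Lspace u).
Definition Lspace_norm (u : Lp) : R := fine 'N[mu]_p[EFin \o (u : T -> R)]%E.

Let zeroE : (Lspace_zero : T -> R) = cst 0 %[ae mu].
Proof. exact: Lspace_of_LfE. Qed.
Let oppE u : (Lspace_opp u : T -> R) = (fun x => - u x) %[ae mu].
Proof. exact: Lspace_of_LfE. Qed.
Let addE u v : (Lspace_add u v : T -> R) = (fun x => u x + v x) %[ae mu].
Proof. exact: Lspace_of_LfE. Qed.
Let scaleE a u : (Lspace_scale a u : T -> R) = (fun x => a * u x) %[ae mu].
Proof. exact: Lspace_of_LfE. Qed.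

Let addA : associative Lspace_add.
Proof.
move=> u v w; apply: Lspace_eqP; near=> x => _.
rewrite (near (addE u (Lspace_add v w)) x)// (near (addE v w) x)//.
by rewrite (near (addE (Lspace_add u v) w) x)// (near (addE u v) x)// addrA.
Unshelve. all: by end_near. Qed.

Let addC : commutative Lspace_add.
Proof.
move=> u v; apply: Lspace_eqP; near=> x => _.
by rewrite (near (addE u v) x)// (near (addE v u) x)// addrC.
Unshelve. all: by end_near. Qed.

Let add0 : left_id Lspace_zero Lspace_add.
Proof.
move=> u; apply: Lspace_eqP; near=> x => _.
by rewrite (near (addE _ u) x)// (near zeroE x)// add0r.
Unshelve. all: by end_near. Qed.

Let addN : left_inverse Lspace_zero Lspace_opp Lspace_add.
Proof.
move=> u; apply: Lspace_eqP; near=> x => _.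
by rewrite (near (addE _ u) x)// (near (oppE u) x)// (near zeroE x)// addNr.
Unshelve. all: by end_near. Qed.

HB.instance Definition _ := GRing.isZmodule.Build Lp addA addC add0 addN.

Let scaleA a b u : Lspace_scale a (Lspace_scale b u) = Lspace_scale (a * b) u.
Proof.
apply: Lspace_eqP; near=> x => _.
rewrite (near (scaleE a (Lspace_scale b u)) x)// (near (scaleE b u) x)//.
by rewrite (near (scaleE (a * b) u) x)// mulrA.
Unshelve. all: by end_near. Qed.

Let scale1 : left_id 1 Lspace_scale.
Proof.
move=> u; apply: Lspace_eqP; near=> x => _.
by rewrite (near (scaleE 1 u) x)// mul1r.
Unshelve. all: by end_near. Qed.

Let scaleDr : right_distributive Lspace_scale +%R.
Proof.
move=> a u v; apply: Lspace_eqP; near=> x => _.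
rewrite (near (scaleE a (u + v)) x)// (near (addE u v) x)//.
rewrite (near (addE (Lspace_scale a u) (Lspace_scale a v)) x)//.
by rewrite (near (scaleE a u) x)// (near (scaleE a v) x)// mulrDr.
Unshelve. all: by end_near. Qed.

Let scaleDl u : {morph Lspace_scale^~ u : a b / a + b}.
Proof.
move=> a b; apply: Lspace_eqP; near=> x => _.
rewrite (near (scaleE (a + b) u) x)//.
rewrite (near (addE (Lspace_scale a u) (Lspace_scale b u)) x)//.
by rewrite (near (scaleE a u) x)// (near (scaleE b u) x)// mulrDl.
Unshelve. all: by end_near. Qed.

HB.instance Definition _ :=
  GRing.Zmodule_isLmodule.Build R Lp scaleA scale1 scaleDr scaleDl.

Lemma Lspace_normE (u : Lp) :
  (Lspace_norm u)%:E = 'N[mu]_p[EFin \o (u : T -> R)]%E.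
Proof. exact: (finite_norm_fine (Lf_of_Lspace u)). Qed.

Let normD (u v : Lp) : Lspace_norm (u + v) <= Lspace_norm u + Lspace_norm v.
Proof.
rewrite -lee_fin EFinD !Lspace_normE (eq_ae_Lnorm _ _ (addE u v)).
- by apply: eminkowski => //; exact: Lspace_measurable.
- exact: Lspace_measurable.
- by apply: measurable_funD; exact: Lspace_measurable.
Qed.

Let normZ (a : R) (u : Lp) : Lspace_norm (a *: u) = `|a| * Lspace_norm u.
Proof.
apply: EFin_inj; rewrite EFinM !Lspace_normE (eq_ae_Lnorm _ _ (scaleE a u)).
- exact: (LnormZ (Lf_of_Lspace u)).
- exact: Lspace_measurable.
- by apply: measurable_funM => //; exact: Lspace_measurable.
Qed.

Let norm0_eq0 (u : Lp) : Lspace_norm u = 0 -> u = 0.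
Proof.
move=> /(fine_Lnormr_eq0 (f := Lf_of_Lspace u)) u0; apply: Lspace_eqP.
by apply: filterS2 u0 zeroE => x /= u0x z0x _; rewrite z0x// -[RHS](u0x I).
Qed.

HB.instance Definition _ := Lmodule_isNormed.Build R Lp normD normZ norm0_eq0.

Lemma Lspace_zeroE : ((0 : Lp) : T -> R) = cst 0 %[ae mu].
Proof. exact: zeroE. Qed.

Lemma Lspace_addE (u v : Lp) :
  ((u + v : Lp) : T -> R) = (fun x => u x + v x) %[ae mu].
Proof. exact: addE. Qed.

Lemma Lspace_scaleE (a : R) (u : Lp) :
  ((a *: u : Lp) : T -> R) = (fun x => a * u x) %[ae mu].
Proof. exact: scaleE. Qed.

End Lspace_normed.

(* Complex-valued L^p: the class of [f] is stored as the classes of ['Re f] and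
   ['Im f], since [f] is measurable (resp. p-integrable) iff both are. *)
Record CLspace d (T : measurableType d) (R : realType)
    (mu : {measure set T -> \bar R}) (p : \bar R) (p1 : (1 <= p)%E) := CLspaceOf
  { CLre : LspaceType mu p1 ; CLim : LspaceType mu p1 }.

Section CLspace_normed.
Context d (T : measurableType d) (R : realType).
Variables (mu : {measure set T -> \bar R}) (p : \bar R) (p1 : (1 <= p)%E).
Local Notation CLp := (CLspace mu p1).
Local Open Scope complex_scope.

Definition CLfun (u : CLp) (x : T) : R[i] := CLre u x +i* CLim u x.

(* [Normc.normc] is the R-valued modulus; the norm of the complex normed space
   below is its image under [%:C], as norms over R[i] take values in R[i]. *)
Definition CLnorm (u : CLp) : R :=
  fine 'N[mu]_p[EFin \o (fun x => Normc.normc (CLfun u x))]%E.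

HB.instance Definition _ := gen_eqMixin CLp.
HB.instance Definition _ := gen_choiceMixin CLp.

Definition CLzero : CLp := CLspaceOf 0 0.
Definition CLopp (u : CLp) : CLp := CLspaceOf (- CLre u) (- CLim u).
Definition CLadd (u v : CLp) : CLp :=
  CLspaceOf (CLre u + CLre v) (CLim u + CLim v).
Definition CLscale (z : R[i]) (u : CLp) : CLp :=
  CLspaceOf
    (complex.Re z *: CLre u - complex.Im z *: CLim u)
    (complex.Im z *: CLre u + complex.Re z *: CLim u).

Let addA : associative CLadd.
Proof. by move=> u v w; rewrite /CLadd /= !addrA. Qed.
Let addC : commutative CLadd.
Proof. by move=> u v; rewrite /CLadd addrC [in X in CLspaceOf _ X]addrC. Qed.
Let add0 : left_id CLzero CLadd.
Proof. by case=> u v; rewrite /CLadd /= !add0r. Qed.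
Let addN : left_inverse CLzero CLopp CLadd.
Proof. by move=> u; rewrite /CLadd /= !addNr. Qed.
HB.instance Definition _ := GRing.isZmodule.Build CLp addA addC add0 addN.

Let scaleA (a b : R[i]) u : CLscale a (CLscale b u) = CLscale (a * b) u.
Proof.
case: a b u => [a a'] [b b'] [u v]; rewrite /CLscale /=.
rewrite !scalerDr !scalerN !scalerA !scalerDl !scaleNr.
congr CLspaceOf.
  by rewrite !opprD addrACA.
by rewrite addrACA; congr (_ + _); exact: addrC.
Qed.

Let scale1 : left_id 1 CLscale.
Proof.
by case=> u v; rewrite /CLscale /= !scale1r !scale0r oppr0 addr0 add0r.
Qed.

Let scaleDr : right_distributive CLscale +%R.
Proof.
move=> z [u v] [u' v']; rewrite /CLscale /=.
rewrite !scalerDr opprD; congr CLspaceOf => /=.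
  by rewrite addrACA.
by rewrite addrACA.
Qed.

Let scaleDl u : {morph CLscale^~ u : a b / a + b}.
Proof.
move=> [a a'] [b b']; case: u => u v; rewrite /CLscale /=.
rewrite !scalerDl opprD; congr CLspaceOf => /=.
  by rewrite addrACA.
by rewrite addrACA.
Qed.

HB.instance Definition _ :=
  GRing.Zmodule_isLmodule.Build R[i] CLp scaleA scale1 scaleDr scaleDl.

Let modulus (u : CLp) x := Normc.normc (CLfun u x).

Let modulus_ge0 u x : 0 <= modulus u x.
Proof. exact: sqrtr_ge0. Qed.

Let measurable_modulus u : measurable_fun setT (modulus u).
Proof.
apply: (@measurableT_comp _ _ _ _ _ _ (@Num.sqrt R)).
  by apply: continuous_measurable_fun; exact: sqrt_continuous.
by apply: measurable_funD; apply: measurable_funX; exact: Lspace_measurable.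
Qed.

Let finite_modulus u : finite_norm mu p (modulus u).
Proof.
pose a x := `|CLre u x|; pose b x := `|CLim u x|.
have ma : measurable_fun setT a.
  by apply: measurableT_comp => //; exact: Lspace_measurable.
have mb : measurable_fun setT b.
  by apply: measurableT_comp => //; exact: Lspace_measurable.
have a0 x : 0 <= a x by exact: normr_ge0.
have b0 x : 0 <= b x by exact: normr_ge0.
have ab0 x : 0 <= (a \+ b) x by exact: addr_ge0.
have h : ('N[mu]_p[EFin \o modulus u] <= 'N[mu]_p[EFin \o (a \+ b)%R])%E.
  apply: le_ae_Lnorm => //; first exact: measurable_funD.
  apply: aeW => x; rewrite !ger0_norm//.
  rewrite -[leRHS]ger0_norm// -[leRHS]sqrtr_sqr ler_wsqrtr//=.
  rewrite sqrrD !real_normK ?num_real// addrAC lerDl.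
  by apply: mulrn_wge0; exact: mulr_ge0.
apply: (le_lt_trans h); apply: (le_lt_trans (eminkowski mu ma mb p1)).
have -> : EFin \o a = abse \o (EFin \o (CLre u : T -> R)) by [].
have -> : EFin \o b = abse \o (EFin \o (CLim u : T -> R)) by [].
by rewrite !Lnorm_abse lte_add_pinfty//; exact: Lspace_Lnorm_lty.
Qed.

Let CLnormE u : (CLnorm u)%:E = 'N[mu]_p[EFin \o modulus u]%E.
Proof.
rewrite fineK// fin_numElt (lt_le_trans ltNy0) ?Lnorm_ge0//=.
exact: finite_modulus.
Qed.

Let normD (u v : CLp) : CLnorm (u + v) <= CLnorm u + CLnorm v.
Proof.
rewrite -lee_fin EFinD !CLnormE.
apply: le_trans (eminkowski _ (measurable_modulus u) (measurable_modulus v) p1).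
apply: le_ae_Lnorm => //; first exact: measurable_funD.
apply: filterS2 (Lspace_addE (CLre u) (CLre v)) (Lspace_addE (CLim u) (CLim v)).
move=> x /(_ I) hr /(_ I) hi; rewrite !ger0_norm ?addr_ge0//.
by rewrite /modulus /CLfun/= hr hi; exact: (le_normcD (CLfun u x) (CLfun v x)).
Qed.

Let normZ (z : R[i]) (u : CLp) : (CLnorm (z *: u))%:C = `|z| * (CLnorm u)%:C.
Proof.
have -> : `|z| = (Normc.normc z)%:C by [].
rewrite -rmorphM/=; congr (_%:C); apply: EFin_inj.
rewrite EFinM !CLnormE.
have mf : modulus u \in Lfun mu p.
  by rewrite inE; apply/andP; split; apply/mem_set;
    [exact: measurable_modulus|exact: finite_modulus].
have z0 : 0 <= Normc.normc z by case: (z) => ? ?; exact: sqrtr_ge0.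
have := LnormZ (Lfun_Sub p1 mf) (Normc.normc z); rewrite ger0_norm// => <-.
apply: eq_ae_Lnorm => //; first exact: measurable_funM.
have hr := Lspace_addE (complex.Re z *: CLre u) (- complex.Im z *: CLim u).
have hi := Lspace_addE (complex.Im z *: CLre u) (complex.Re z *: CLim u).
have h1 := Lspace_scaleE (complex.Re z) (CLre u).
have h2 := Lspace_scaleE (- complex.Im z) (CLim u).
have h3 := Lspace_scaleE (complex.Im z) (CLre u).
have h4 := Lspace_scaleE (complex.Re z) (CLim u).
near=> x => _.
transitivity (Normc.normc (z * CLfun u x)); last exact: Normc.normcM.
rewrite /modulus /CLfun/= -scaleNr (near hr x)// (near hi x)// (near h1 x)//.
rewrite (near h2 x)// (near h3 x)// (near h4 x)//.
by case: (z) => a b /=; rewrite mulNr [b * _ + _]addrC.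
Unshelve. all: by end_near. Qed.

Let norm0_eq0 (u : CLp) : (CLnorm u)%:C = 0 -> u = 0.
Proof.
move=> /eqP; rewrite (_ : 0 = 0%:C)// eq_complex/= eqxx andbT => /eqP u0.
have := CLnormE u; rewrite u0 => /esym/Lnorm_eq0_eq0 => h.
have {}h : EFin \o modulus u = \0%E %[ae mu].
  apply: h; first exact/measurable_EFinP.
  exact: lt_le_trans p1.
have eq0 x : modulus u x = 0 -> CLre u x = 0 /\ CLim u x = 0.
  by move=> /Normc.eq0_normc/eqP; rewrite eq_complex => /andP[/eqP ? /eqP ?].
have [vw0 z0] : {ae mu, forall x, modulus u x = 0} /\
    {ae mu, forall x, (0 : LspaceType mu p1) x = 0}.
  by split; [move: h|move: (Lspace_zeroE mu p1)]; apply: filterS => x /(_ I) // [].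
case: (u) eq0 vw0 => v w eq0 vw0; congr CLspaceOf; apply: Lspace_eqP;
  by apply: filterS2 vw0 z0 => x /eq0[/= v0 w0] zx _; rewrite zx.
Qed.

Let CnormD (u v : CLp) :
  (CLnorm (u + v))%:C <= (CLnorm u)%:C + (CLnorm v)%:C.
Proof. by rewrite -rmorphD/= lecR. Qed.

HB.instance Definition _ :=
  Lmodule_isNormed.Build R[i] CLp CnormD normZ norm0_eq0.

End CLspace_normed.

(* [max A_i], for the 1-based index [i] *)
Definition digit_max (i : nat) : nat := if odd i then (2 * i).-1 else 1.

(* Sequences are 0-based: [x k] is the coordinate of index [i = k.+1], so that
   parities and weights below are always taken at [k.+1]. *)
Definition odo_seq : Type := forall k : nat, 'I_(digit_max k.+1).+1.

HB.instance Definition _ := gen_eqMixin odo_seq.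
HB.instance Definition _ := gen_choiceMixin odo_seq.
HB.instance Definition _ := isPointed.Build odo_seq (fun=> ord0).

Definition coord_preimages : set (set odo_seq) :=
  [set C | exists k (B : set 'I_(digit_max k.+1).+1), C = [set x | B (x k)]].

Definition odo_space := g_sigma_algebraType coord_preimages.

Section product_measure.
Context {R : realType}.

Definition atom_mass (i j : nat) : R :=
  if odd i then
    (if (j < i)%N then (1 - 2 ^- i) / i%:R else 2 ^- i / i%:R)
  else 2^-1.

Definition factor_measure (i : nat) (B : set 'I_(digit_max i).+1) : R :=
  \sum_(j | j \in B) atom_mass i j.

(* The product measure is the unique probability measure on the product
   sigma-algebra with these values on measurable rectangles. *)
Definition is_product_measure (mu : probability odo_space R) : Prop :=
  forall (n : nat) (B : forall k : nat, set 'I_(digit_max k.+1).+1),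
    mu [set x : odo_space | forall k, (k < n)%N -> B k (x k)] =
    (\prod_(k < n) factor_measure (B k))%:E.

End product_measure.

Definition odometer (x : odo_space) : odo_space :=
  match pselect (exists k, (x k < digit_max k.+1)%N) with
  | left not_max =>
      let l := ex_minn not_max in
      fun k => if (k < l)%N then ord0
               else if k == l then inord (x k).+1 else x k
  | right _ => fun=> ord0
  end.

(* [rep u] is a representative of the class [u]; [T] must send the class of
   every [g], whichever representative it is, to the class of [g \o f]. This
   determines [T] uniquely on [LspaceType] and on [CLspace]. *)
Definition is_composition_operator d (X : measurableType d) (R : realType)
    (mu : {measure set X -> \bar R}) (f : X -> X) (E K : Type)
    (rep : E -> X -> K) (T : E -> E) : Prop :=
  forall (u : E) (g : X -> K),
    rep u = g %[ae mu] -> rep (T u) = g \o f %[ae mu].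

Definition bounded_operator (K : numFieldType) (E : normedModType K)
    (T : E -> E) : Prop :=
  exists C : K, forall u : E, `|T u| <= C * `|u|.

Definition topologically_transitive (E : topologicalType) (T : E -> E) : Prop :=
  forall U V : set E, open U -> open V -> U !=set0 -> V !=set0 ->
    exists k : nat, (iter k T @` U) `&` V !=set0.

(* Main.v *)
Require Import Defs.
From HB Require Import structures.
From mathcomp Require Import all_boot all_order all_algebra.
From mathcomp Require Import complex.
From mathcomp Require Import all_classical all_reals all_analysis.
From mathcomp Require Import measurable_realfun ring lra.
Set Implicit Arguments.
Unset Strict Implicit.
Unset Printing Implicit Defensive.
Import Order.TTheory GRing.Theory Num.Theory.
Import numFieldNormedType.Exports.
Local Open Scope classical_set_scope.
Local Open Scope ring_scope.

(* Let D_n be the set of points whose digit at the odd index i = 2n + 1 is at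
   least i; its measure is 2^-i. With N the product of the sizes of the first
   i - 1 factors, f^(i N) adds i to the digit of index i without carry when that
   digit is less than i, so it maps the complement of D_n into D_n and changes
   nothing else. Given bounded phi and psi, the function equal to phi off D_n and
   to psi composed with the inverse shift on D_n is close to phi in L^p, and its
   image under T_f^(i N) agrees with psi off D_n, so is close to psi.

   T_f is bounded because mu (f^-1 S) <= 8 mu S: up to null sets, f is piecewise
   the replacement of a prefix (max, ..., max, j) by (0, ..., 0, j + 1), and the
   masses of these two words are in ratio at most 8. *)

(** * Real L^p: small supports and approximation by bounded functions *)

Section Lspace_facts.
Context d (X : measurableType d) (R : realType) (mu : {measure set X -> \bar R}).
Variables (p : R) (p1 : (1 <= p%:E)%E).
Local Notation Lp := (LspaceType mu p1).

Let p_gt0 : 0 < p. Proof. exact: lt_le_trans ltr01 p1. Qed.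

Lemma Lspace_of_fun (g : X -> R) : measurable_fun setT g ->
  finite_norm mu p%:E g -> exists u : Lp, (u : X -> R) = g %[ae mu].
Proof.
move=> mg fg.
have gP : g \in Lfun mu p%:E by rewrite inE; apply/andP; split; apply/mem_set.
by exists (Lspace_of_Lf (Lfun_Sub p1 gP)); exact: Lspace_of_LfE.
Qed.

Lemma norm_aeE (u : Lp) (g : X -> R) : measurable_fun setT g ->
  (u : X -> R) = g %[ae mu] -> (`|u|%:E = 'N[mu]_(p%:E)[EFin \o g])%E.
Proof.
move=> mg ug; rewrite [LHS]Lspace_normE; apply: eq_ae_Lnorm => //.
exact: Lspace_measurable.
Qed.

Lemma Lspace_subE (u v : Lp) :
  ((u - v : Lp) : X -> R) = (fun x => u x - v x) %[ae mu].
Proof.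
have h1 := Lspace_addE u (- v); have h2 := Lspace_scaleE (-1) v.
near=> x => _; rewrite (near h1 x)// -scaleN1r (near h2 x)// mulN1r//.
Unshelve. all: by end_near. Qed.

Lemma finite_normD (g h : X -> R) : measurable_fun setT g ->
  measurable_fun setT h -> finite_norm mu p%:E g -> finite_norm mu p%:E h ->
  finite_norm mu p%:E (g \+ h).
Proof.
move=> mg mh fg fh; apply: le_lt_trans (eminkowski mu mg mh p1) _.
by rewrite lte_add_pinfty.
Qed.

(** Since [|h|] is dominated by [M] times the indicator of [D], a bounded change on a set of small
    measure is small in L^p. *)
Lemma Lnorm_le_bounded_support (M : R) (D : set X) (h : X -> R) :
  measurable_fun setT h -> measurable D ->
  0 <= M -> (forall x, `|h x| <= M) -> (forall x, ~ D x -> h x = 0) ->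
  ('N[mu]_(p%:E)[EFin \o h] <= M%:E * mu D `^ p^-1)%E.
Proof.
move=> mh mD M0 hM hD.
have -> : (M%:E * mu D `^ p^-1 = ((M `^ p)%:E * mu D) `^ p^-1)%E.
  rewrite poweRM ?lee_fin ?powR_ge0// poweR_EFin -powRrM mulfV ?gt_eqF//.
  by rewrite powRr1.
rewrite unlock; apply: gt0_ler_poweR; rewrite ?in_itv/= ?leey ?andbT.
- by rewrite invr_ge0 ltW.
- by apply: integral_ge0 => x _; rewrite lee_fin powR_ge0.
- by apply: mule_ge0; rewrite ?lee_fin ?powR_ge0.
have -> : ((M `^ p)%:E * mu D = \int[mu]_x ((M `^ p)%:E * (\1_D x)%:E))%E.
  rewrite ge0_integralZl_EFin ?powR_ge0 ?integral_indic ?setIT//.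
  by apply/measurable_EFinP; exact: measurable_indic.
apply: ge0_le_integral => //.
- apply: measurableT_comp => //; apply: (measurableT_comp (measurable_powR _)).
  exact: measurableT_comp.
- by apply: measurable_funeM; apply/measurable_EFinP; exact: measurable_indic.
move=> x _; rewrite /= -EFinM lee_fin indicE; have [xD|xD] := boolP (x \in D).
  by rewrite mulr1 ge0_ler_powR ?nnegrE// ltW.
by rewrite hD ?normr0 ?powR0 ?gt_eqF ?mulr0// => /mem_set; apply/negP.
Qed.

Definition clip (n : nat) (y : R) : R := Num.max (- n%:R) (Num.min n%:R y).

Lemma clip_bounded n y : `|clip n y| <= n%:R.
Proof.
rewrite ler_norml /clip le_max lexx/= ge_max ge_min lexx orTb andbT.
by rewrite (le_trans _ (ler0n _ _))// oppr_le0.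
Qed.

Lemma clip_id n y : `|y| <= n%:R -> clip n y = y.
Proof.
by rewrite ler_norml /clip => /andP[h1 h2]; rewrite min_r// max_r.
Qed.

(** Gives the dominating function [|u| ^ p] for the convergence of truncations. *)
Lemma clip_sub n y : `|y - clip n y| <= `|y|.
Proof.
have n0 : 0 <= n%:R :> R by [].
have [y0|y0] := lerP 0 y.
  rewrite /clip max_r; last first.
    by rewrite le_min !(le_trans _ n0) ?(le_trans _ y0) ?oppr_le0.
  by rewrite ger0_norm ?subr_ge0 ?ge_min ?lexx ?orbT// ger0_norm// gerBl le_min n0.
rewrite /clip min_r ?(le_trans (ltW y0))//.
rewrite ler0_norm ?subr_le0 ?le_max ?lexx ?orbT// opprB ltr0_norm//.
by rewrite gerDr ge_max (ltW y0) oppr_le0 n0.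
Qed.

Lemma measurable_clip n (g : X -> R) : measurable_fun setT g ->
  measurable_fun setT (clip n \o g).
Proof. by move=> mg; apply: measurable_maxr => //; exact: measurable_minr. Qed.

(** The truncations [clip n \o u] work by dominated convergence: at each point the error vanishes
    once [n] exceeds [|u x|]. *)
Lemma bounded_dense (u : Lp) (e : R) : 0 < e -> exists (M : R) (phi : X -> R),
  [/\ measurable_fun setT phi, forall x, `|phi x| <= M,
      finite_norm mu p%:E phi &
      ('N[mu]_(p%:E)[EFin \o (fun x => phi x - u x)%R] < e%:E)%E].
Proof.
move=> e0; pose phi n := clip n \o (u : X -> R).
have mu_ := Lspace_measurable u.
have mphi n : measurable_fun setT (phi n) by exact: measurable_clip.
have up : (u : X -> R) \in Lfun mu p%:E by exact: Lf_of_Lspace_proof.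
have iu := Lfun_integrable p1 up.
pose h n x := (`|phi n x - u x| `^ p)%:E.
have mh n : measurable_fun setT (h n).
  apply: measurableT_comp => //; apply: (measurableT_comp (measurable_powR _)).
  by apply: measurableT_comp => //; exact: measurable_funB.
have := @dominated_cvg _ _ _ mu setT measurableT h (cst 0%E) _ mh _ _ iu _.
rewrite integral0 => cvgh.
have {cvgh} : (\int[mu]_x h n x @[n --> \oo] --> 0)%E.
  apply: cvgh => //.
    move=> x _; apply: cvg_near_cst.
    have [n un] : exists n : nat, `|u x| <= n%:R.
      exists (Num.truncn `|u x|).+1; apply: ltW; exact: Num.Theory.truncnS_gt.
    exists n => // m /= nm; rewrite /h /phi /= clip_id ?subrr ?normr0 ?powR0 ?gt_eqF//.
    by rewrite (le_trans un)// ler_nat.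
  move=> n x _; rewrite /h /= ger0_norm ?powR_ge0// lee_fin.
  by apply: ge0_ler_powR; rewrite ?nnegrE ?(ltW p_gt0)// distrC; exact: clip_sub.
(* Taking p-th roots is used only as a weakly monotone operation, so half of [e] is aimed at to
   recover a strict bound. *)
have e2 : 0 < e / 2 by rewrite divr_gt0.
have ep : (0 < ((e / 2) `^ p)%:E)%E by rewrite lte_fin powR_gt0.
move=> /(_ _ (open_ereal_lt' ep)) [n _ /(_ n (leqnn _)) hn].
exists n%:R, (phi n); split => //.
- by move=> x; exact: clip_bounded.
- have -> : phi n = (fun x => phi n x - u x) \+ u.
    by apply/funext => x /=; rewrite subrK.
  apply: finite_normD => //.
  + exact: measurable_funB.
  + rewrite /finite_norm unlock poweR_lty//.
    by apply: lt_trans (ltry ((e / 2) `^ p)); exact: hn.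
  + exact: Lspace_Lnorm_lty.
- rewrite unlock; apply: (@le_lt_trans _ _ (((e / 2) `^ p)%:E `^ p^-1)%E).
    apply: gt0_ler_poweR; rewrite ?invr_ge0 ?(ltW p_gt0)// ?in_itv/= ?leey ?andbT.
    + by apply: integral_ge0 => x _; rewrite lee_fin powR_ge0.
    + by rewrite lee_fin powR_ge0.
    + exact: ltW.
  rewrite poweR_EFin -powRrM mulfV ?gt_eqF// powRr1 ?(ltW e2)// lte_fin.
  by rewrite ltr_pdivrMr// ltr_pMr// ltr1n.
Qed.

End Lspace_facts.

(** * Composition operators under the bound mu (f^-1 S) <= C mu S *)

Section composition_operator.
Context d (X : measurableType d) (R : realType) (mu : {measure set X -> \bar R}).
Variables (p : R) (p1 : (1 <= p%:E)%E) (f : X -> X) (C : R).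
Hypotheses (mf : measurable_fun setT f) (C0 : 0 <= C).
Hypothesis muf :
  forall S, measurable S -> (mu (f @^-1` S) <= C%:E * mu S)%E.
Local Notation Lp := (LspaceType mu p1).
Local Notation CLp := (CLspace mu p1).

Let p_gt0 : 0 < p. Proof. exact: lt_le_trans ltr01 p1. Qed.

(** By [muf], preimages of null sets are null; this makes composition with [f] well defined on
    classes. *)
Lemma ae_comp (P : set X) :
  {ae mu, forall x, P x} -> {ae mu, forall x, P (f x)}.
Proof.
move=> [N [mN N0 PN]]; exists (f @^-1` N); split.
- by rewrite -[_ @^-1` _]setTI; exact: mf.
- by apply/eqP; rewrite eq_le measure_ge0 andbT (le_trans (muf mN))// N0 mule0.
- by move=> x /= Px; exact: PN.
Qed.

Lemma ae_eq_comp (Y : Type) (g h : X -> Y) :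
  g = h %[ae mu] -> g \o f = h \o f %[ae mu].
Proof. exact: (@ae_comp (fun x => setT x -> g x = h x)). Qed.

(** The left side is the integral of [g] against the pushforward of [mu], a measure dominated by [C]
    times [mu]. *)
Lemma integral_comp_le (g : X -> \bar R) : measurable_fun setT g ->
  (forall x, 0 <= g x)%E ->
  (\int[mu]_x (g (f x)) <= C%:E * \int[mu]_x (g x))%E.
Proof.
move=> mg g0.
have := @ge0_integral_pushforward _ _ X X R f mf mu setT g measurableT mg
  (fun x _ => g0 x).
rewrite preimage_setT => <-.
pose k : {nonneg R} := NngNum C0.
rewrite -[C]/(k%:num) -ge0_integral_mscale//.
exact: ge0_le_measure_integral.
Qed.

Lemma Lnorm_comp_le (g : X -> R) : measurable_fun setT g ->
  ('N[mu]_(p%:E)[EFin \o (g \o f)] <=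
   (C `^ p^-1)%:E * 'N[mu]_(p%:E)[EFin \o g])%E.
Proof.
move=> mg; rewrite unlock -poweR_EFin -poweRM//; last first.
  by apply: integral_ge0 => x _; rewrite lee_fin powR_ge0.
have i0 (h : X -> R) : (0 <= \int[mu]_x (`|(EFin \o h) x| `^ p))%E.
  by apply: integral_ge0 => x _; rewrite lee_fin powR_ge0.
apply: gt0_ler_poweR; rewrite ?invr_ge0 ?(ltW p_gt0)// ?in_itv/= ?leey ?andbT//.
- exact: i0.
- by apply: mule_ge0 => //; exact: i0.
apply: (@integral_comp_le (fun x => (`|g x| `^ p)%:E)).
  apply: measurableT_comp => //; apply: (measurableT_comp (measurable_powR _)).
  exact: measurableT_comp.
by move=> x; rewrite lee_fin powR_ge0.
Qed.

Lemma finite_norm_comp (g : X -> R) : measurable_fun setT g ->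
  finite_norm mu p%:E g -> finite_norm mu p%:E (g \o f).
Proof.
move=> mg fg; apply: le_lt_trans (Lnorm_comp_le mg) _.
rewrite lte_mul_pinfty ?lee_fin ?powR_ge0//.
Qed.

Lemma comp_op_subproof (u : Lp) : (u : X -> R) \o f \in Lfun mu p%:E.
Proof.
have mu_ := Lspace_measurable u.
rewrite inE; apply/andP; split; apply/mem_set; first exact: measurableT_comp.
by apply: finite_norm_comp => //; exact: Lspace_Lnorm_lty.
Qed.

Definition comp_op (u : Lp) : Lp := Lspace_of_Lf (Lfun_Sub p1 (comp_op_subproof u)).

Lemma comp_opE (u : Lp) : (comp_op u : X -> R) = (u : X -> R) \o f %[ae mu].
Proof. exact: Lspace_of_LfE. Qed.

Lemma comp_op_linear : linear comp_op.
Proof.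
move=> a u v; apply: Lspace_eqP.
have h1 := comp_opE (a *: u + v).
have h2 := ae_eq_comp (Lspace_addE (a *: u) v).
have h3 := ae_eq_comp (Lspace_scaleE a u).
have h4 := Lspace_addE (a *: comp_op u) (comp_op v).
have h5 := Lspace_scaleE a (comp_op u).
have h6 := comp_opE u; have h7 := comp_opE v.
near=> x => _.
rewrite (near h1 x)// (near h2 x)//= -[(a *: u : Lp) (f x)]/((_ \o f) x).
rewrite (near h3 x)//= (near h4 x)// (near h5 x)// (near h6 x)// (near h7 x)//.
Unshelve. all: by end_near. Qed.

HB.instance Definition _ := GRing.isLinear.Build R Lp Lp *:%R comp_op comp_op_linear.

Lemma comp_op_is_composition :
  is_composition_operator mu f (fun u : Lp => (u : X -> R)) comp_op.
Proof.
move=> u g ug; apply: ae_eq_trans (comp_opE u) _; exact: ae_eq_comp.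
Qed.

Lemma comp_op_norm (u : Lp) : `|comp_op u| <= C `^ p^-1 * `|u|.
Proof.
rewrite -lee_fin EFinM [X in (_ <= _ * X)%E]Lspace_normE.
rewrite (norm_aeE _ (comp_opE u)); first exact/Lnorm_comp_le/Lspace_measurable.
by apply: measurableT_comp => //; exact: Lspace_measurable.
Qed.

Lemma comp_op_bounded : bounded_operator comp_op.
Proof. by exists (C `^ p^-1) => u; exact: comp_op_norm. Qed.

(** The induction runs over all representatives, because one application of the operator turns [g]
    into [g \o f]. *)
Lemma iter_comp_opE (k : nat) (u : Lp) (g : X -> R) : (u : X -> R) = g %[ae mu] ->
  (iter k comp_op u : X -> R) = g \o iter k f %[ae mu].
Proof.
elim: k u g => [//|k IH] u g ug; rewrite iterSr.
have -> : g \o iter k.+1 f = (g \o f) \o iter k f.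
  by apply/funext => x /=; rewrite -iterS.
exact/IH/comp_op_is_composition.
Qed.

Definition Ccomp_op (u : CLp) : CLp :=
  CLspaceOf (comp_op (CLre u)) (comp_op (CLim u)).

Lemma Ccomp_op_linear : linear Ccomp_op.
Proof.
move=> [a b] [u v] [u' v'].
by congr CLspaceOf => /=; rewrite !linearD/= ?linearN/= !linearZ.
Qed.

HB.instance Definition _ :=
  GRing.isLinear.Build R[i]%C CLp CLp *:%R Ccomp_op Ccomp_op_linear.

Lemma Ccomp_op_is_composition :
  is_composition_operator mu f (@CLfun _ _ _ mu _ p1) Ccomp_op.
Proof.
move=> u g ug; have := ae_eq_comp ug.
have h1 := comp_opE (CLre u); have h2 := comp_opE (CLim u) => h3.
near=> x => _; rewrite -(near h3 x)// /CLfun/= (near h1 x)// (near h2 x)//.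
Unshelve. all: by end_near. Qed.

Lemma iter_Ccomp_op (k : nat) (u v : Lp) :
  iter k Ccomp_op (CLspaceOf u v) =
  CLspaceOf (iter k comp_op u) (iter k comp_op v).
Proof. by elim: k => [//|k /= ->]. Qed.

End composition_operator.

(** * Comparison of the complex norm with the norms of real and imaginary parts *)

Section CLspace_facts.
Context d (X : measurableType d) (R : realType) (mu : {measure set X -> \bar R}).
Variables (p : R) (p1 : (1 <= p%:E)%E).
Local Notation Lp := (LspaceType mu p1).
Local Notation CLp := (CLspace mu p1).

Let modulus (u : CLp) x := Normc.normc (CLfun u x).

Let modulus_ge0 u x : 0 <= modulus u x.
Proof. exact: sqrtr_ge0. Qed.

Lemma measurable_CLmodulus (u : CLp) :
  measurable_fun setT (fun x => Normc.normc (CLfun u x)).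
Proof.
apply: (@measurableT_comp _ _ _ _ _ _ (@Num.sqrt R)).
  by apply: continuous_measurable_fun; exact: sqrt_continuous.
by apply: measurable_funD; apply: measurable_funX; exact: Lspace_measurable.
Qed.

(** Pointwise, the modulus is at most the sum of the absolute values of the two parts; Minkowski's
    inequality does the rest. *)
Let Lnorm_modulus_le (u : CLp) :
  ('N[mu]_(p%:E)[EFin \o modulus u] <= (`|CLre u| + `|CLim u|)%R%:E)%E.
Proof.
have mre := Lspace_measurable (CLre u); have mim := Lspace_measurable (CLim u).
have h (v : Lp) : ('N[mu]_(p%:E)[EFin \o (fun x => `|v x|%R)] = `|v|%:E)%E.
  by rewrite [RHS]Lspace_normE; exact: (Lnorm_abse mu (EFin \o (v : X -> R))).
rewrite EFinD -!h; apply: le_trans (eminkowski _ _ _ p1); last 2 first.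
- exact: measurableT_comp.
- exact: measurableT_comp.
apply: le_ae_Lnorm => //; first exact: measurable_CLmodulus.
  by apply: measurable_funD; exact: measurableT_comp.
apply: aeW => x; rewrite !ger0_norm ?addr_ge0//=.
rewrite -[leRHS]ger0_norm ?addr_ge0// -[leRHS]sqrtr_sqr ler_wsqrtr//=.
rewrite sqrrD !real_normK ?num_real// addrAC lerDl.
by apply: mulrn_wge0; exact: mulr_ge0.
Qed.

Let CLnormE (u : CLp) : (CLnorm u)%:E = ('N[mu]_(p%:E)[EFin \o modulus u])%E.
Proof.
rewrite fineK// ge0_fin_numE ?Lnorm_ge0//.
by apply: le_lt_trans (Lnorm_modulus_le u) _; exact: ltry.
Qed.

Lemma CLnorm_le_add (u : CLp) : CLnorm u <= `|CLre u| + `|CLim u|.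
Proof. by rewrite -lee_fin CLnormE; exact: Lnorm_modulus_le. Qed.

Lemma CLre_norm_le (u : CLp) : `|CLre u| <= CLnorm u.
Proof.
rewrite -lee_fin CLnormE [leLHS]Lspace_normE.
apply: le_ae_Lnorm => //; [exact: Lspace_measurable|exact: measurable_CLmodulus|].
apply: aeW => x; rewrite [leRHS]ger0_norm//.
by rewrite -sqrtr_sqr ler_wsqrtr// lerDl sqr_ge0.
Qed.

Lemma CLim_norm_le (u : CLp) : `|CLim u| <= CLnorm u.
Proof.
rewrite -lee_fin CLnormE [leLHS]Lspace_normE.
apply: le_ae_Lnorm => //; [exact: Lspace_measurable|exact: measurable_CLmodulus|].
apply: aeW => x; rewrite [leRHS]ger0_norm//.
by rewrite -sqrtr_sqr ler_wsqrtr// lerDr sqr_ge0.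
Qed.

End CLspace_facts.

Lemma open_normP (K : numFieldType) (E : normedModType K) (U : set E) (u : E) :
  open U -> U u -> exists2 e : K, 0 < e & forall w, `|w - u| < e -> U w.
Proof.
move=> oU Uu; have /nbhs_normP[e e0 eU] := open_nbhs_nbhs (conj oU Uu).
by exists e => // w we; apply: eU; rewrite /= distrC.
Qed.

(** * An abstract transitivity criterion *)

Section transitivity.
Context d (X : measurableType d) (R : realType) (mu : {measure set X -> \bar R}).
Variables (p : R) (p1 : (1 <= p%:E)%E) (f : X -> X) (C : R).
Hypotheses (mf : measurable_fun setT f) (C0 : 0 <= C).
Hypothesis muf :
  forall S, measurable S -> (mu (f @^-1` S) <= C%:E * mu S)%E.
Local Notation Lp := (LspaceType mu p1).
Local Notation CLp := (CLspace mu p1).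
Local Notation T := (comp_op (p1 := p1) mf C0 muf).
Local Notation CT := (Ccomp_op (p1 := p1) mf C0 muf).

(** For the odometer, with i = 2n + 1: [k n] is the exponent i N, [D n] is the set D_n, and [g n]
    subtracts i from the digit of index i. *)
Variables (k : nat -> nat) (D : nat -> set X) (g : nat -> X -> X).
Hypothesis mD : forall n, measurable (D n).
Hypothesis muD0 : (mu (D n) @[n --> \oo] --> 0)%E.
Hypothesis mg : forall n, measurable_fun setT (g n).
Hypothesis fkD : forall n x, ~ D n x -> D n (iter (k n) f x).
Hypothesis gfk : forall n x, ~ D n x -> g n (iter (k n) f x) = x.

Let p_gt0 : 0 < p. Proof. exact: lt_le_trans ltr01 p1. Qed.

Let small_support (M e : R) : 0 <= M -> 0 < e ->
  \forall n \near \oo, (M%:E * mu (D n) `^ p^-1 < e%:E)%E.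
Proof.
move=> M0 e0.
(* If the measure is below [c], the product is at most [M * (e / (M + 1)) < e]; adding 1 covers the
   case [M = 0]. *)
pose c := (e / (M + 1)) `^ p.
have c0 : (0 < c%:E)%E.
  by rewrite lte_fin; apply: powR_gt0; rewrite divr_gt0// ltr_wpDl.
have [m _ hm] := muD0 (open_ereal_lt' c0).
exists m => // n mn; have /= Dn := hm n mn.
apply: (@le_lt_trans _ _ (M%:E * (e / (M + 1))%:E)%E).
  rewrite lee_wpmul2l ?lee_fin//.
  have -> : ((e / (M + 1))%:E = c%:E `^ p^-1)%E.
    by rewrite poweR_EFin /c -powRrM mulfV ?gt_eqF// powRr1// divr_ge0 ?addr_ge0// ltW.
  apply: gt0_ler_poweR; rewrite ?invr_ge0 ?(ltW p_gt0)// ?in_itv/= ?leey ?andbT//.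
  - exact: ltW.
  - exact: ltW.
rewrite -EFinM lte_fin mulrCA gtr_pMr// ltr_pdivrMr ?ltr_wpDl// mul1r.
by rewrite ltrDl.
Qed.

(** Stated for all large [n], not just for one, so that real and imaginary parts can later be
    treated with the same exponent. *)
Lemma comp_op_approx_along (u v : Lp) (e : R) : 0 < e ->
  \forall n \near \oo, exists w : Lp,
    `|w - u| < e /\ `|iter (k n) T w - v| < e.
Proof.
move=> e0; have e2 : 0 < e / 2 by rewrite divr_gt0.
have [M [phi [mphi Mphi fphi uphi]]] := bounded_dense u e2.
have [N [psi [mpsi Npsi fpsi vpsi]]] := bounded_dense v e2.
have M0 : 0 <= M by apply: le_trans (Mphi point).
have N0 : 0 <= N by apply: le_trans (Npsi point).
(* One bound for both error terms: [h] is bounded by [M + N], so [h - phi] is at most [M + N] on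
   [D n], and [s] below is at most [(M + N) + N]. *)
pose B := M + N + N.
have B0 : 0 <= B by rewrite !addr_ge0.
have := small_support B0 e2; apply: filterS => n small.
have mu_ := Lspace_measurable u; have mv_ := Lspace_measurable v.
pose h x := if x \in D n then psi (g n x) else phi x.
have mpg : measurable_fun setT (psi \o g n) by exact: measurableT_comp.
have mh : measurable_fun setT h.
  apply: measurable_fun_if => //.
  - apply: (@measurable_fun_bool _ _ _ _ true).
    rewrite setTI (_ : _ @^-1` _ = D n)//.
    by apply/seteqP; split => x /=; [move/set_mem|move/mem_set].
  - by apply: measurable_funS mpg.
  - by apply: measurable_funS mphi.
have MNB : M + N <= B by rewrite lerDl.
have hM x : `|h x| <= M + N.
  by rewrite /h; case: ifP => _; [apply: le_trans (Npsi _) _; rewrite lerDr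
    |apply: le_trans (Mphi _) _; rewrite lerDl].
pose r x := h x - phi x.
have mr : measurable_fun setT r by exact: measurable_funB.
have r0 x : ~ D n x -> r x = 0.
  by move=> Dx; rewrite /r /h memNset// subrr.
have rB x : `|r x| <= B.
  rewrite /r /h; case: ifP => _; last by rewrite subrr normr0.
  by rewrite (le_trans (ler_normB _ _))// (le_trans _ MNB)// addrC lerD.
have Nr := Lnorm_le_bounded_support mu p1 mr (mD n) B0 rB r0.
have fr : finite_norm mu p%:E r.
  by apply: le_lt_trans Nr _; apply: lt_trans small _; exact: ltry.
have fh : finite_norm mu p%:E h.
  have -> : h = r \+ phi by apply/funext => x /=; rewrite subrK.
  exact: (finite_normD p1).
have [w wh] := Lspace_of_fun p1 mh fh.
exists w; split.
  (* [w - u] splits into [h - phi], supported in [D n], and [phi - u]; each part has norm below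
     [e / 2]. *)
  rewrite -lte_fin (@norm_aeE _ _ _ _ _ _ _ (r \+ (fun x => phi x - u x))).
  - apply: le_lt_trans (eminkowski _ _ _ p1) _ => //; first exact: measurable_funB.
    rewrite [e]splitr EFinD lteD// (le_lt_trans Nr)//.
  - by apply: measurable_funD => //; exact: measurable_funB.
  - have h1 := Lspace_subE w u; near=> x => _.
    by rewrite (near h1 x)// (near wh x)// /r /= addrA subrK.
pose s x := h (iter (k n) f x) - psi x.
have mfk : measurable_fun setT (iter (k n) f).
  by elim: (k n) => [|m IH]; [exact: measurable_id|exact: measurableT_comp].
have mhf : measurable_fun setT (h \o iter (k n) f) by exact: measurableT_comp.
have ms : measurable_fun setT s by exact: measurable_funB.
(* Off [D n] the iterate lands in [D n], where [h] is [psi \o g n], and [g n] undoes the iterate. *)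
have s0 x : ~ D n x -> s x = 0.
  move=> Dx; rewrite /s /h mem_set; last exact: fkD.
  by rewrite gfk// subrr.
have sB x : `|s x| <= B by rewrite (le_trans (ler_normB _ _))// lerD.
have Ns := Lnorm_le_bounded_support mu p1 ms (mD n) B0 sB s0.
rewrite -lte_fin (@norm_aeE _ _ _ _ _ _ _ (s \+ (fun x => psi x - v x))).
- apply: le_lt_trans (eminkowski _ _ _ p1) _ => //; first exact: measurable_funB.
  by rewrite [e]splitr EFinD lteD// (le_lt_trans Ns).
- by apply: measurable_funD => //; exact: measurable_funB.
- have h1 := Lspace_subE (iter (k n) T w) v.
  have h2 := iter_comp_opE mf C0 muf (k n) wh.
  near=> x => _.
  by rewrite (near h1 x)// (near h2 x)// /s /= addrA subrK.
Unshelve. all: by end_near. Qed.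

Lemma comp_op_transitive : topologically_transitive T.
Proof.
move=> U V oU oV [u Uu] [v Vv].
have [e e0 eU] := open_normP oU Uu; have [e' e'0 eV] := open_normP oV Vv.
have m0 : 0 < Num.min e e' by rewrite lt_min e0.
have [n _ /(_ n (leqnn n)) [w []]] := comp_op_approx_along u v m0.
rewrite !lt_min => /andP[we _] /andP[_ wv].
by exists (k n), (iter (k n) T w); split; [exists w => //; exact: eU|exact: eV].
Qed.

(** The factor 2 arises because the norm is at most the sum of the norms of the two parts, each at
    most the complex norm. *)
Lemma Ccomp_op_bounded : bounded_operator CT.
Proof.
exists ((C `^ p^-1 * 2)%:C)%C => u.
have -> : `|CT u| = (CLnorm (CT u))%:C%C by [].
have -> : `|u| = (CLnorm u)%:C%C by [].
rewrite -rmorphM lecR (le_trans (CLnorm_le_add _))// -mulrA mulr_natl mulrnAr.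
rewrite mulr2n lerD// (le_trans (comp_op_norm _ _ _ _))//.
  by rewrite ler_wpM2l ?powR_ge0 ?CLre_norm_le.
by rewrite ler_wpM2l ?powR_ge0 ?CLim_norm_le.
Qed.

Lemma Ccomp_op_transitive : topologically_transitive CT.
Proof.
move=> U V oU oV [u Uu] [v Vv].
have near_in (W : set CLp) (a : CLp) : open W -> W a -> exists2 e : R, 0 < e &
    forall b : CLp, `|CLre b - CLre a| < e -> `|CLim b - CLim a| < e -> W b.
  move=> oW Wa; have [[e e'] e0 eW] := open_normP oW Wa.
  (* The radius is a complex number; being positive, it has imaginary part 0. *)
  move: e0 eW; rewrite ltcE => /andP[/= /eqP -> e0] eW.
  exists (e / 2) => [|b h1 h2]; first exact: divr_gt0.
  apply: eW; have -> : `|b - a| = (CLnorm (b - a))%:C%C by [].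
  rewrite (_ : (e +i* 0)%C = e%:C%C)// ltcR (le_lt_trans (CLnorm_le_add _))//.
  by rewrite [X in _ < X]splitr ltrD.
have [e e0 eU] := near_in _ _ oU Uu; have [e' e'0 eV] := near_in _ _ oV Vv.
have m0 : 0 < Num.min e e' by rewrite lt_min e0.
(* Both approximations hold for all large [n], hence for a common one. *)
have [n [[r [r1 r2]] [i [i1 i2]]]] := @filter_ex _ _ _ _
  (filterI (comp_op_approx_along (CLre u) (CLre v) m0)
           (comp_op_approx_along (CLim u) (CLim v) m0)).
move: r1 r2 i1 i2; rewrite !lt_min.
move=> /andP[r1 _] /andP[_ r2] /andP[i1 _] /andP[_ i2].
exists (k n), (iter (k n) CT (CLspaceOf r i)); split.
  by exists (CLspaceOf r i) => //; exact: eU.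
by rewrite iter_Ccomp_op; exact: eV.
Qed.

End transitivity.

(** * Digit arithmetic of the odometer: iterates and preimages *)

Section odometer_iterates.
Local Open Scope nat_scope.
Local Notation dmax k := (digit_max k.+1).
Implicit Types (x : odo_space) (i k m a b : nat).

(** For [i <= k], this says that a carry entering at position [i] reaches position [k]. *)
Definition carry i k x := [forall j : 'I_k, (i <= j) ==> (x j == dmax j :> nat)].

Definition csucc k (a : 'I_(dmax k).+1) : 'I_(dmax k).+1 :=
  if a < dmax k then inord a.+1 else ord0.

(** The odometer acting on the digits from position [i] on. The digitwise form needs no first
    non-maximal digit, so it also covers sequences whose digits are all maximal. *)
Definition odo_from i x : odo_space :=
  fun k => if (i <= k) && carry i k x then csucc (x k) else x k.

Definition upd i a x : odo_space := fun k => if k == i then inord a else x k.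

Lemma odo_ext x (y : odo_space) : (forall k, x k = y k :> nat) -> x = y.
Proof. by move=> h; apply: functional_extensionality_dep => k; exact/val_inj/h. Qed.

Lemma digit_le x k : x k <= dmax k.
Proof. by rewrite -ltnS. Qed.

Lemma carryP i k x :
  reflect (forall j, i <= j < k -> x j = dmax j :> nat) (carry i k x).
Proof.
apply: (iffP forallP) => [h j /andP[ij jk]|h j].
  by apply/eqP; exact: (implyP (h (Ordinal jk))).
by apply/implyP => ij; apply/eqP/h; rewrite ij ltn_ord.
Qed.

Lemma csuccE k (a : 'I_(dmax k).+1) :
  csucc a = (if a < dmax k then a.+1 else 0) :> nat.
Proof. by rewrite /csucc; case: ifP => // h; rewrite inordK ?ltnS. Qed.

Lemma updE i a x : a <= dmax i -> upd i a x i = a :> nat.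
Proof. by move=> h; rewrite /upd eqxx inordK ?ltnS. Qed.

Lemma updNE i a x k : k != i -> upd i a x k = x k.
Proof. by rewrite /upd => /negbTE ->. Qed.

Lemma upd_upd i a b x : upd i a (upd i b x) = upd i a x.
Proof.
by apply: functional_extensionality_dep => k; rewrite /upd; case: (k == i).
Qed.

Lemma upd_id i x : upd i (x i) x = x.
Proof.
apply: odo_ext => k; have [->|ki] := eqVneq k i; last by rewrite updNE.
by rewrite updE ?digit_le.
Qed.

(** Before the first non-maximal digit all digits wrap to 0, that digit receives the carry, and
    nothing beyond it does; without such a digit everything wraps. *)
Lemma odometerE : odometer = odo_from 0.
Proof.
apply/funext => x; apply: functional_extensionality_dep => k.
rewrite /odometer /odo_from leq0n andTb; case: pselect => [h|h].
  case: ex_minnP => l xl lmin.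
  have below j : j < l -> x j = dmax j :> nat.
    move=> jl; apply/eqP; rewrite eqn_leq digit_le /= leqNgt.
    by apply/negP => /lmin; rewrite leqNgt jl.
  case: ltngtP => kl.
  - have -> : carry 0 k x by apply/carryP => j /= jk; apply: below; exact: ltn_trans kl.
    by rewrite /csucc below// ltnn.
  - have -> // : carry 0 k x = false.
    by apply/negP => /carryP/(_ l kl) e; rewrite e ltnn in xl.
  - subst l; have -> : carry 0 k x by apply/carryP => j /= jk; exact: below.
    by rewrite /csucc xl.
have full j : x j = dmax j :> nat.
  apply/eqP; rewrite eqn_leq digit_le /= leqNgt.
  by apply/negP => xj; apply: h; exists j.
have -> : carry 0 k x by apply/carryP => j _; exact: full.
by rewrite /csucc full ltnn.
Qed.

Lemma odo_from_lt i x : x i < dmax i -> odo_from i x = upd i (x i).+1 x.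
Proof.
move=> xi; apply: functional_extensionality_dep => k.
rewrite /odo_from /upd; have [<-|ki] := eqVneq i k.
  rewrite leqnn /csucc xi ifT//.
  by apply/carryP => j /andP[/leq_ltn_trans/[apply]]; rewrite ltnn.
case: ifP => // /andP[ik /carryP/(_ i)].
by rewrite leqnn ltn_neqAle ki ik => /(_ isT) e; rewrite e ltnn in xi.
Qed.

(** The maximal digit wraps and hands the carry on to position [i.+1]. *)
Lemma odo_from_max i x : x i = dmax i :> nat ->
  odo_from i x = upd i 0 (odo_from i.+1 x).
Proof.
move=> xi; apply: odo_ext => k; have [->|ki] := eqVneq k i.
  rewrite updE// /odo_from leqnn ifT ?csuccE ?xi ?ltnn//.
  by apply/carryP => j /andP[/leq_ltn_trans/[apply]]; rewrite ltnn.
rewrite updNE// /odo_from [i < k]ltn_neqAle eq_sym ki /=.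
suff -> : carry i k x = carry i.+1 k x by [].
apply/carryP/carryP => h j /andP[ij jk].
  by apply: h; rewrite jk (ltnW ij).
move: ij; rewrite leq_eqVlt => /predU1P[<-//|ij].
by apply: h; rewrite ij.
Qed.

(** [odo_from i.+1] neither changes the digit at [i] nor consults it for the other digits. *)
Lemma odo_from_upd i a x :
  odo_from i.+1 (upd i a x) = upd i a (odo_from i.+1 x).
Proof.
apply: functional_extensionality_dep => k; rewrite /odo_from.
have -> : carry i.+1 k (upd i a x) = carry i.+1 k x.
  by apply/carryP/carryP => h j ijk; have := h _ ijk; rewrite updNE//;
    case/andP: ijk => ij _; rewrite gtn_eqF.
have [->|ki] := eqVneq k i; first by rewrite ltnn/= /upd eqxx.
by rewrite !updNE.
Qed.

Lemma iter_odo_from i m x : x i + m <= dmax i ->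
  iter m (odo_from i) x = upd i (x i + m) x.
Proof.
elim: m => [_|m IH h]; first by rewrite addn0 upd_id.
have h' : x i + m < dmax i by rewrite -addnS.
rewrite iterS IH ?(ltnW h')// odo_from_lt ?updE ?(ltnW h')// upd_upd.
by rewrite addnS.
Qed.

(** One full turn of digit [i]: it climbs to its maximum, wraps once with a single carry to [i.+1],
    then climbs back to its initial value. *)
Lemma iter_odo_from_period i x :
  iter (dmax i).+1 (odo_from i) x = odo_from i.+1 x.
Proof.
have xi := digit_le x i.
have -> : (dmax i).+1 = x i + (dmax i - x i).+1 by rewrite addnS subnKC.
rewrite iterD iterS (@iter_odo_from i (dmax i - x i)) subnKC// odo_from_max ?updE//.
rewrite odo_from_upd upd_upd iter_odo_from ?updE// add0n upd_upd.
by rewrite -odo_from_upd upd_id.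
Qed.

Definition odo_period i := \prod_(j < i) (dmax j).+1.

Lemma iter_odometer_period i x : iter (odo_period i) odometer x = odo_from i x.
Proof.
elim: i x => [|i IH] x; first by rewrite /odo_period big_ord0 /= odometerE.
rewrite /odo_period big_ord_recr /= -/(odo_period i) mulnC iterM.
rewrite -iter_odo_from_period; apply: eq_iter => y; exact: IH.
Qed.

(* No carry leaves position [i], so all the other digits are preserved. *)
Lemma iter_odometer_digit i m x : x i + m <= dmax i ->
  iter (m * odo_period i) odometer x = upd i (x i + m) x.
Proof.
move=> h; rewrite iterM -iter_odo_from//.
by apply: eq_iter => y; exact: iter_odometer_period.
Qed.

Definition zero_seq : odo_space := fun=> ord0.
Definition max_seq : odo_space := fun=> ord_max.
Definition replace n (y x : odo_space) : odo_space :=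
  fun k => if k < n then y k else x k.
Definition cyl n (y : odo_space) : set odo_space :=
  [set x | forall k, k < n -> x k = y k].

(** Reading the output from position 0: each output 0 below [l] forces a maximal input digit, which
    keeps the carry alive; the nonzero output at [l] stops it, so the tail is unchanged. *)
Lemma odometer_preimage l j x : j < dmax l ->
  cyl l.+1 (upd l j.+1 zero_seq) (odometer x) ->
  cyl l.+1 (upd l j max_seq) x /\
  odometer x = replace l.+1 (upd l j.+1 zero_seq) x.
Proof.
move=> jl; rewrite odometerE => h.
have hv k : k < l.+1 -> odo_from 0 x k = upd l j.+1 zero_seq k :> nat.
  by move=> kl; rewrite h.
have odoE k : carry 0 k x -> odo_from 0 x k = csucc (x k) by rewrite /odo_from => ->.
have xmax : forall k, k < l -> x k = dmax k :> nat.
  elim/ltn_ind => k IH kl.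
  have ck : carry 0 k x by apply/carryP => i ik; exact: IH (ltn_trans ik kl).
  have := hv k (ltnW kl); rewrite odoE// updNE ?ltn_eqF// csuccE/=.
  by case: ltnP => // mx _; apply/eqP; rewrite eqn_leq digit_le.
have xl : x l = j :> nat.
  have cl : carry 0 l x by apply/carryP.
  have := hv l (ltnSn l); rewrite odoE// updE// csuccE.
  by case: ifP => // _ [].
split=> [k kl|].
  apply: val_inj => /=; have [->|kNl] := eqVneq k l; first by rewrite updE ?(ltnW jl).
  by rewrite updNE//= xmax// ltn_neqAle kNl -ltnS.
apply: functional_extensionality_dep => k; rewrite /replace.
case: ltnP => kl; first exact: h.
rewrite /odo_from; case: ifP => // /carryP/(_ l kl) e.
by rewrite -e xl ltnn in jl.
Qed.

(** The carry never stops here, so the same reading forces every input digit to be maximal. *)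
Lemma odometer_preimage0 x : odometer x = zero_seq -> x = max_seq.
Proof.
rewrite odometerE => h; apply: odo_ext; elim/ltn_ind => k IH.
have ck : carry 0 k x by apply/carryP => i; exact: IH.
have : odo_from 0 x k = 0 :> nat by rewrite h.
rewrite /odo_from ck csuccE; case: ltnP => // mx _.
by apply/eqP; rewrite eqn_leq digit_le.
Qed.

End odometer_iterates.

(** * Measurability and the generating pi-system of boxes *)

Section odometer_measurability.
Local Notation dmax k := (digit_max k.+1).

Lemma measurable_digit k (B : set 'I_(dmax k).+1) :
  measurable [set x : odo_space | B (x k)].
Proof. by apply: sub_sigma_algebra; exists k, B. Qed.

Lemma measurable_odo_fun (F : odo_space -> odo_space) :
  (forall k (B : set 'I_(dmax k).+1), measurable [set x | B (F x k)]) ->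
  measurable_fun setT F.
Proof.
move=> h; apply: (@measurability _ _ odo_space odo_space _ _ coord_preimages) => //.
by move=> _ [_ [k [B ->]] <-]; rewrite setTI; exact: h.
Qed.

Lemma measurable_upd i (phi : 'I_(dmax i).+1 -> nat) :
  measurable_fun setT (fun x : odo_space => upd i (phi (x i)) x).
Proof.
apply: measurable_odo_fun => k B; rewrite /upd; case: (k == i).
  exact: (measurable_digit (fun a => B (inord (phi a)))).
exact: measurable_digit.
Qed.

Lemma measurable_replace n (y : odo_space) :
  measurable_fun setT (replace n y).
Proof.
apply: measurable_odo_fun => k B; rewrite /replace; case: (k < n)%N.
  have [h|h] := pselect (B (y k)).
    by rewrite (_ : [set _ | _] = setT)//; apply/seteqP; split.
  by rewrite (_ : [set _ | _] = set0)//; apply/seteqP; split.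
exact: measurable_digit.
Qed.

Definition box n (B : forall k, set 'I_(dmax k).+1) : set odo_space :=
  [set x | forall k, (k < n)%N -> B k (x k)].

Lemma measurable_box n (B : forall k, set 'I_(dmax k).+1) : measurable (box n B).
Proof.
rewrite (_ : box n B = \bigcap_(k in `I_n) [set x : odo_space | B k (x k)])//.
by apply: bigcap_measurableType => k _; exact: measurable_digit.
Qed.

Lemma measurable_odometer : measurable_fun setT odometer.
Proof.
rewrite odometerE; apply: measurable_odo_fun => k B.
have mc : measurable [set x : odo_space | carry 0 k x].
  rewrite (_ : [set _ | _] = box k (fun j => [set ord_max])).
    exact: measurable_box.
  apply/seteqP; split => x /=.
    by move=> /carryP h j jk; apply: val_inj => /=; exact: h.
  by move=> h; apply/carryP => j /= jk; rewrite h.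
rewrite (_ : [set _ | _] =
  ([set x | carry 0 k x] `&` [set x | B (csucc (x k))]) `|`
  (~` [set x | carry 0 k x] `&` [set x | B (x k)])).
  apply: measurableU; apply: measurableI => //.
  - exact: (measurable_digit (fun a => B (csucc a))).
  - exact: measurableC.
  - exact: measurable_digit.
apply/seteqP; split => x /=; rewrite /odo_from /=; case: ifP => c.
- by left.
- by right; split => //; rewrite c.
- by move=> [[]|[]].
- by move=> [[]|[]] => //; rewrite c.
Qed.

Lemma cyl_box n (y : odo_space) : cyl n y = box n (fun k => [set y k]).
Proof. by []. Qed.

Lemma measurable_cyl n (y : odo_space) : measurable (cyl n y).
Proof. by rewrite cyl_box; exact: measurable_box. Qed.

(** Padding with full factors makes the length a sum, so that products over the factors can be split
    at a chosen position. *)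
Lemma box_widen m n (B : forall k, set 'I_(dmax k).+1) :
  box n B = box (m + n) (fun k => if (k < n)%N then B k else setT).
Proof.
apply/seteqP; split => x /= h k kn.
  by case: ifP => // kn'; exact: h.
by have := h k (ltn_addl m kn); rewrite kn.
Qed.

Lemma box_setI m n (A B : forall k, set 'I_(dmax k).+1) :
  box m A `&` box n B = box (m + n)
    (fun k => (if (k < m)%N then A k else setT) `&` (if (k < n)%N then B k else setT)).
Proof.
apply/seteqP; split => x /=.
  move=> [hA hB] k _; split; case: ifP => //; [exact: hA|exact: hB].
move=> h; split=> k kn.
  by have := h k (ltn_addr n kn); rewrite kn => -[].
by have := h k (ltn_addl m kn); rewrite kn => -[].
Qed.

Lemma measurable_odo_box :
  measurable = <<s [set S | exists n B, S = box n B] >> :> set (set odo_space).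
Proof.
apply/seteqP; split.
  apply: smallest_sub; first exact: smallest_sigma_algebra.
  move=> _ [k [B ->]]; apply: sub_sigma_algebra; exists k.+1.
  (* The digit type depends on the position, so [B] is transported along an equality [j = k]; for
     [j] other than [k] the constraint is vacuous. *)
  pose P j (a : 'I_(dmax j).+1) :=
    forall e : j = k, B (eq_rect j (fun j => 'I_(dmax j).+1) a k e).
  exists P; apply/seteqP; split => x /=.
    by move=> Bx j jk e; subst k.
  by move=> h; exact: (h k (ltnSn k) erefl).
apply: smallest_sub; first exact: sigma_algebra_measurable.
by move=> _ [n [B ->]]; exact: measurable_box.
Qed.

End odometer_measurability.

Lemma measure_le_bigcup d (T : measurableType d) (R : realType)
    (m1 m2 : {measure set T -> \bar R}) (A : set T) (E : nat -> set T) :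
  measurable A -> (forall n, measurable (E n)) -> trivIset setT E ->
  (forall n, m1 (A `&` E n) <= m2 (A `&` E n))%E ->
  (m1 (A `&` \bigcup_n E n) <= m2 (A `&` \bigcup_n E n))%E.
Proof.
move=> mA mE tE leE; rewrite setI_bigcupr.
have mAE n : measurable (A `&` E n) by exact: measurableI.
have tAE : trivIset setT (fun n => A `&` E n) by exact: trivIset_setIl.
rewrite !measure_semi_bigcup//; try exact: bigcup_measurable.
by apply: lee_nneseries => // n _; exact: leE.
Qed.

(** * Product measure: the bound mu (f^-1 S) <= 8 mu S and the measure of D_n *)

Section product_measure_facts.
Context (R : realType) (mu : probability odo_space R).
Hypothesis mu_product : is_product_measure mu.
Local Notation dmax k := (digit_max k.+1).
Local Notation atom k a := (@atom_mass R k.+1 a).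

Lemma mu_box n (B : forall k, set 'I_(dmax k).+1) :
  mu (box n B) = (\prod_(k < n) factor_measure (B k))%:E.
Proof. exact: mu_product. Qed.

(** As [mu] has total mass 1, the product of the first [n] total masses is 1 for every [n];
    comparing lengths [k] and [k.+1] isolates one factor. *)
Lemma factor_setT k : factor_measure (setT : set 'I_(dmax k).+1) = 1 :> R.
Proof.
have h n : \prod_(i < n) factor_measure (setT : set 'I_(dmax i).+1) = 1 :> R.
  apply: EFin_inj; rewrite -(mu_box n (fun=> setT)) -(@probability_setT _ _ _ mu).
  by congr (mu _); apply/seteqP; split.
by have := h k.+1; rewrite big_ord_recr /= h mul1r.
Qed.

Lemma factor_set1 k (a : 'I_(dmax k).+1) :
  factor_measure [set a] = atom k a.
Proof.
rewrite /factor_measure (big_pred1 a)// => j.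
by apply/idP/eqP => [/set_mem//|->]; rewrite inE.
Qed.

Lemma mu_cyl n (y : odo_space) : mu (cyl n y) = (\prod_(k < n) atom k (y k))%:E.
Proof.
rewrite cyl_box mu_box; congr EFin; apply: eq_bigr => k _; exact: factor_set1.
Qed.

Lemma atom_ge0 k a : 0 <= atom k a.
Proof.
rewrite /atom_mass; case: ifP => _; last by rewrite invr_ge0.
case: ifP => _; rewrite divr_ge0// ?invr_ge0 ?exprn_ge0//.
by rewrite subr_ge0 invf_le1 ?exprn_gt0// exprn_ege1// ler1n.
Qed.

Lemma prod_atom_ge0 n (y : nat -> nat) : 0 <= \prod_(k < n) atom k (y k).
Proof. by apply: prodr_ge0 => k _; exact: atom_ge0. Qed.

(** The cylinder constrains the digits below [n], whereas [replace n z] depends only on the others.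
    As functions of [S] both sides are measures, so it suffices to compare them on boxes. *)
Lemma cyl_replace_indep n (y z : odo_space) (S : set odo_space) : measurable S ->
  (mu (cyl n y `&` replace n z @^-1` S) =
   mu (cyl n y) * mu (replace n z @^-1` S))%E.
Proof.
move=> mS.
have c0 : 0 <= \prod_(k < n) atom k (y k) by exact: (prod_atom_ge0 n y).
have mr := measurable_replace n z.
pose m1 : {measure set odo_space -> \bar R} :=
  pushforward (mrestr mu (measurable_cyl n y)) (replace n z).
pose m2 : {measure set odo_space -> \bar R} :=
  mscale (NngNum c0) (pushforward mu (replace n z)).
have -> : mu (cyl n y `&` replace n z @^-1` S) = m1 mr S.
  by rewrite setIC.
have -> : (mu (cyl n y) * mu (replace n z @^-1` S))%E = m2 mr S.
  by rewrite mu_cyl.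
apply: (measure_unique _ (fun=> setT) measurable_odo_box) => //.
- by move=> _ _ [p [A ->]] [q [B ->]]; rewrite box_setI; eexists; eexists.
- by move=> _; exists 0, (fun=> setT); apply/seteqP; split.
- by apply/seteqP; split => // x _; exists 0.
- move=> _ [m [B ->]]; rewrite (box_widen n).
  set B' := (fun k => _); rewrite /m1 /m2 /= /mrestr /mscale/= /pushforward.
  have [zB|zB] := pselect (forall k, (k < n)%N -> B' k (z k)); last first.
    rewrite (_ : replace n z @^-1` _ = set0) ?set0I ?measure0 ?mule0//.
    apply/seteqP; split => // x h; apply: zB => k kn.
    by have := h k (ltn_addr m kn); rewrite /replace kn.
  have -> : replace n z @^-1` box (n + m) B' =
      box (n + m) (fun k => if (k < n)%N then setT else B' k).
    apply/seteqP; split => x h k kn; have := h k kn; rewrite /replace.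
      by case: ifP.
    by case: ifP => // kn' _; exact: zB.
  have -> : box (n + m) (fun k => if (k < n)%N then setT else B' k) `&` cyl n y =
      box (n + m) (fun k => if (k < n)%N then [set y k] else B' k).
    apply/seteqP; split => x.
      by move=> [h c] k kn; have := h k kn; case: ifP => // kn' _; exact: c.
    move=> h; split => k kn; last first.
      by have := h k (ltn_addr m kn); rewrite kn.
    by have := h k kn; case: ifP.
  rewrite !mu_box -EFinM; congr EFin; rewrite !big_split_ord/=.
  rewrite [X in _ = _ * (X * _)]big1 ?mul1r; last first.
    by move=> i _; rewrite ltn_ord factor_setT.
  congr (_ * _); apply: eq_bigr => i _.
    by rewrite ltn_ord factor_set1.
  by rewrite ltnNge leq_addr.
- move=> _; rewrite /m1 /= /mrestr /pushforward preimage_setT setTI.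
  by rewrite mu_cyl ltry.
Qed.

(** By independence, changing the prefix from [y] to [z] costs only the ratio of the two cylinder
    masses. *)
Lemma cyl_replace_le n (y z : odo_space) (c : R) (S : set odo_space) :
  measurable S -> 0 <= c -> (mu (cyl n y) <= c%:E * mu (cyl n z))%E ->
  (mu (cyl n y `&` replace n z @^-1` S) <= c%:E * mu (S `&` cyl n z))%E.
Proof.
move=> mS c0 yz; have mr := measurable_replace n z.
have -> : S `&` cyl n z = cyl n z `&` replace n z @^-1` S.
  rewrite setIC; apply/seteqP; split => x [xz /=].
    suff -> : replace n z x = x by [].
    by apply: odo_ext => k; rewrite /replace; case: ifP => // /xz ->.
  suff -> : replace n z x = x by [].
  by apply: odo_ext => k; rewrite /replace; case: ifP => // /xz ->.
rewrite !cyl_replace_indep// muleA lee_wpmul2r//.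
Qed.

(** At index 1 both masses are 1/2; at a larger odd index the denominator is at least 2. *)
Lemma atom_le_half k a : atom k a <= 2^-1.
Proof.
rewrite /atom_mass; case: ifP => // ok.
have [k0|k0] := posnP k.
  subst k; case: ifP => _; rewrite divr1//.
  by rewrite expr1 -[X in X - _]mulr1 lerBlDr -mulr2n -[_ *+ 2]mulr_natr mulVf ?mulr1.
have k2 : (2 <= k.+1)%N by [].
have hk : (k.+1%:R)^-1 <= 2^-1 :> R by rewrite lef_pV2 ?posrE// ler_nat.
have p1 : 2 ^- k.+1 <= 1 :> R by rewrite invf_le1 ?exprn_gt0// exprn_ege1// ler1n.
have p0 : 0 <= 2 ^- k.+1 :> R by rewrite invr_ge0 exprn_ge0.
by case: ifP => _; rewrite -[leRHS]mul1r ler_pM ?subr_ge0 ?invr_ge0 ?ler0n ?gerBl.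
Qed.

Lemma atom_even k a : odd k -> atom k a = 2^-1.
Proof. by move=> ok; rewrite /atom_mass /= ok. Qed.

Lemma digit_max_oddE i : odd i -> digit_max i = (i + i.-1)%N.
Proof. by case: i => // i; rewrite /digit_max => ->; rewrite mul2n -addnn addnS. Qed.

(** At odd index i the maximal digit is a light one and 0 a heavy one, and 2^-i <= 1 - 2^-i because
    i >= 1. *)
Lemma atom_max_le k : atom k (dmax k) <= atom k 0.
Proof.
rewrite /atom_mass; case: ifP => // ok.
rewrite digit_max_oddE// ltnNge leq_addr /=.
rewrite ler_pM2r ?invr_gt0// lerBrDr -mulr2n -[_ *+ 2]mulr_natr.
rewrite exprS invfM mulrC mulrA mulfV// mul1r invf_le1 ?exprn_gt0//.
by rewrite exprn_ege1// ler1n.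
Qed.

(** With i = 2m + 1 the constant is 2^i. The mass changes only from digit i - 1 to digit i, where it
    is divided by 2^i - 1. *)
Lemma atom_succ_le m a :
  atom m.*2 a <= 2 * 4 ^+ m * atom m.*2 a.+1.
Proof.
have e : 2 * 4 ^+ m = 2 ^+ m.*2.+1 :> R by rewrite exprS -mul2n exprM expr2 -natrM.
have h1 : 1 <= 2 ^+ m.*2.+1 :> R by rewrite exprn_ege1// ler1n.
have E := exprn_gt0 m.*2.+1 (ltr0n R 2).
rewrite e /atom_mass /= odd_double /=; case: (ltnP a) => h; last first.
  by rewrite ltnNge (leqW h) /= ler_peMl// divr_ge0 ?invr_ge0 ?ltW.
case: ltnP => h'.
  by rewrite ler_peMl// divr_ge0// subr_ge0 invf_le1.
by rewrite mulrA mulfV ?gt_eqF// ler_pM2r ?invr_gt0// gerBl invr_ge0 ltW.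
Qed.

Lemma prod_atom_max_le n :
  \prod_(k < n) atom k (dmax k) <= \prod_(k < n) atom k 0.
Proof. by apply: ler_prod => k _; rewrite atom_ge0 atom_max_le. Qed.

(* Each pair of an odd and an even index beyond the first pair multiplies the
   ratio of the two products by 1 / (2 ^ i - 1), with i >= 3 odd. *)
Lemma prod_atom_max_decay m :
  4 ^+ m * \prod_(k < m.*2) atom k (dmax k) <= 4 * \prod_(k < m.*2) atom k 0.
Proof.
have [->|] := posnP m; first by rewrite !big_ord0 expr0 !mulr1 ler1n.
(* The factor 4 on the right pays for the first pair: at indices 1 and 2 every mass is 1/2, so there
   is no decay yet. *)
elim: m => // -[|m] IH _; first by rewrite expr1 ler_pM2l// prod_atom_max_le.
have {}IH := IH isT.
have oe : odd m.+1.*2.+1 by rewrite /= odd_double.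
have l1 : (1 < m.+1.*2)%N by [].
rewrite doubleS exprS; move: m.+1.*2 IH oe l1 => l IH oe l1.
rewrite !big_ord_recr/=.
set A := \prod_(k < _) _ in IH *; set Z := \prod_(k < _) _ in IH *.
rewrite !(@atom_even l.+1)// !mulrA ler_pM2r ?invr_gt0//.
rewrite [X in X <= _](_ : _ = (4 ^+ m.+1 * A) * (4 * atom l (dmax l))); last by ring.
apply: ler_pM => //.
- by rewrite mulr_ge0 ?exprn_ge0//; exact: (prod_atom_ge0 l (fun k => dmax k)).
- by rewrite mulr_ge0 ?atom_ge0.
(* What remains is 4 * 2^-i <= 1 - 2^-i, that is 5 <= 2^i, which follows from i >= 3. *)
rewrite /atom_mass oe digit_max_oddE// ltnNge leq_addr /= mulrA ler_pM2r ?invr_gt0//.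
rewrite lerBrDr -[X in _ + X]mul1r -mulrDl ler_pdivrMr ?exprn_gt0// mul1r.
rewrite (@le_trans _ _ (2 ^+ 3))//; first by lra.
by rewrite ler_weXn2l// ler1n.
Qed.

(** For [l] odd (even index) the last digits have equal mass and the prefix ratio is at most 1. For
    [l = 2m] the last digits contribute at most 2 * 4^m and the prefix at most 4 / 4^m, whence 8. *)
Lemma mu_word_le l j : (j < dmax l)%N ->
  (mu (cyl l.+1 (upd l j max_seq)) <=
   8%:E * mu (cyl l.+1 (upd l j.+1 zero_seq)))%E.
Proof.
move=> jl; rewrite !mu_cyl -EFinM lee_fin !big_ord_recr/= !updE ?(ltnW jl)//.
rewrite (eq_bigr (fun k : 'I_l => atom k (dmax k))); last first.
  by move=> k _; rewrite updNE// ltn_eqF.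
rewrite [in leRHS](eq_bigr (fun k : 'I_l => atom k 0)); last first.
  by move=> k _; rewrite updNE// ltn_eqF.
have Z0 := prod_atom_ge0 l (fun=> 0%N).
have [ol|el] := boolP (odd l).
  rewrite !atom_even// mulrA ler_pM2r ?invr_gt0//.
  by rewrite (le_trans (prod_atom_max_le l))// ler_peMl// ler1n.
have lE : l = l./2.*2 by rewrite -[LHS]odd_double_half (negbTE el).
have := prod_atom_max_decay l./2; rewrite -lE => hl.
have := atom_succ_le l./2 j; rewrite -lE => hj.
apply: le_trans (ler_wpM2l (prod_atom_ge0 l (fun k => dmax k)) hj) _.
rewrite [leLHS](_ : _ =
  (2 * (4 ^+ l./2 * \prod_(k < l) atom k (dmax k))) * atom l j.+1); last first.
  by ring.
rewrite [leRHS]mulrA ler_wpM2r ?atom_ge0//.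
rewrite [leRHS](_ : _ = 2 * (4 * \prod_(k < l) atom k 0)) ?ler_pM2l//.
by ring.
Qed.

Lemma measurable_odo_set1 (y : odo_space) : measurable [set y].
Proof.
rewrite (_ : [set _] = \bigcap_n cyl n y).
  by apply: bigcap_measurableType => n _; exact: measurable_cyl.
apply/seteqP; split => [_ -> //|x h].
by apply: odo_ext => k; rewrite (h k.+1 I k (ltnSn k)).
Qed.

(** The point lies in cylinders of length [n] and mass at most 2^-n. *)
Lemma mu_max_seq : mu [set max_seq] = 0%E.
Proof.
apply/eqP; rewrite eq_le measure_ge0 andbT; apply/lee_addgt0Pr => e e0.
rewrite add0e; have [n hn] : exists n, 2 ^- n <= e :> R.
  have [n _ /(_ n (leqnn n)) hn] := near_infty_natSinv_expn_lt (PosNum e0).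
  by exists n; rewrite -div1r ltW.
apply: (@le_trans _ _ (mu (cyl n max_seq))).
  apply: le_measure; rewrite ?inE;
    [exact: measurable_odo_set1|exact: measurable_cyl|].
  by move=> _ ->.
rewrite mu_cyl lee_fin (le_trans _ hn)//.
rewrite -exprVn -[X in _ ^+ X](card_ord n) -prodr_const.
by apply: ler_prod => k _; rewrite atom_ge0 atom_le_half.
Qed.

(** These pieces partition the complement of [zero_seq], and over each of them the odometer is a
    single prefix replacement. They are empty when [j] is too large, which lets [j] range over all
    of [nat]. *)
Definition first_nonzero l j : set odo_space :=
  [set y | (forall k, (k < l)%N -> y k = ord0) /\ y l = j.+1 :> nat].

Lemma first_nonzero_cyl l j : (j < dmax l)%N ->
  first_nonzero l j = cyl l.+1 (upd l j.+1 zero_seq).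
Proof.
move=> jl; apply/seteqP; split => y.
  move=> [y0 yl] k kl; apply: val_inj => /=.
  have [->|kNl] := eqVneq k l; first by rewrite updE.
  by rewrite updNE// y0// ltn_neqAle kNl -ltnS.
move=> h; split => [k kl|]; last by rewrite (h l (ltnSn l)) updE.
by rewrite (h k (leqW kl)) updNE// ltn_eqF.
Qed.

Lemma first_nonzero_empty l j : (dmax l <= j)%N -> first_nonzero l j = set0.
Proof.
move=> lj; apply/seteqP; split => // y [_ yl].
by have := digit_le y l; rewrite yl leqNgt ltnS lj.
Qed.

Lemma measurable_first_nonzero l j : measurable (first_nonzero l j).
Proof.
have [jl|lj] := ltnP j (dmax l); last by rewrite first_nonzero_empty.
by rewrite first_nonzero_cyl//; exact: measurable_cyl.
Qed.

(** The preimage lies in the cylinder of the word (max, ..., max, j), where the odometer agrees with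
    [replace], so the mass ratio of the two words applies. *)
Lemma mu_odometer_word l j (S : set odo_space) : measurable S ->
  (mu (odometer @^-1` (S `&` first_nonzero l j)) <=
   8%:E * mu (S `&` first_nonzero l j))%E.
Proof.
move=> mS; have [jl|lj] := ltnP j (dmax l); last first.
  by rewrite first_nonzero_empty// setI0 preimage_set0 measure0 mule0.
rewrite first_nonzero_cyl//.
apply: le_trans (cyl_replace_le mS _ (mu_word_le jl)) => //.
apply: le_measure; rewrite ?inE.
- rewrite -[_ @^-1` _]setTI; apply: measurable_odometer => //.
  by apply: measurableI => //; exact: measurable_cyl.
- apply: measurableI; first exact: measurable_cyl.
  by rewrite -[_ @^-1` _]setTI; exact: measurable_replace.
by move=> x [Sx /(odometer_preimage jl)[cx e]]; split => //=; rewrite -e.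
Qed.

(** The bounds on the pieces are summed over [j], then over [l]; the leftover point [zero_seq] has
    the null preimage [max_seq]. *)
Lemma mu_odometer_le (S : set odo_space) : measurable S ->
  (mu (odometer @^-1` S) <= 8%:E * mu S)%E.
Proof.
move=> mS.
pose m1 : {measure set odo_space -> \bar R} := pushforward mu odometer.
pose m2 : {measure set odo_space -> \bar R} := mscale (NngNum (ler0n R 8)) mu.
have mo := measurable_odometer.
rewrite -[leLHS]/(m1 mo S) -[leRHS]/(m2 S).
pose Z l := \bigcup_j first_nonzero l j.
have mZ l : measurable (Z l).
  by apply: bigcup_measurable => j _; exact: measurable_first_nonzero.
have tfirst l : trivIset setT (first_nonzero l).
  by move=> j j' _ _ [y [[_ yj] [_]]]; rewrite yj => -[].
have tZ : trivIset setT Z.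
  apply: ltn_trivIset => l l' ll'; apply/seteqP; split => // y.
  move=> [[j _ [_ yj]] [j' _ [y0 _]]].
  by move: yj; rewrite y0.
have leZ l : (m1 mo (S `&` Z l) <= m2 (S `&` Z l))%E.
  apply: measure_le_bigcup => //; first exact: measurable_first_nonzero.
  by move=> j; exact: mu_odometer_word.
have cover : ~` [set zero_seq] `<=` \bigcup_l Z l.
  move=> y yN0; have ex : exists k, y k != ord0.
    apply: contrapT => h; apply: yN0; apply: functional_extensionality_dep => k.
    by apply/eqP; apply: contrapT => /negP yk; apply: h; exists k.
  case: (ex_minnP ex) => l yl lmin; exists l => //; exists (y l).-1 => //.
  split=> [k kl|]; last by rewrite prednK// lt0n.
  by apply/eqP; apply: contraTT kl => /lmin; rewrite -leqNgt.
have m0 : m1 mo [set zero_seq] = 0%E.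
  apply/eqP; rewrite eq_le measure_ge0 andbT -mu_max_seq.
  rewrite -[leLHS]/(mu (odometer @^-1` [set zero_seq])).
  apply: le_measure; rewrite ?inE; last by move=> x /odometer_preimage0.
    rewrite -[_ @^-1` _]setTI; apply: measurable_odometer => //.
    exact: measurable_odo_set1.
  exact: measurable_odo_set1.
have mU : measurable (\bigcup_l Z l) by exact: bigcup_measurable.
(* [S] outside the pieces is contained in the singleton of [zero_seq], which is null for [m1]. *)
rewrite (measureDI (m1 mo) mS mU) -[leRHS]add0e; apply: leeD.
  rewrite -m0; apply: le_measure; rewrite ?inE.
  - exact: measurableD.
  - exact: measurable_odo_set1.
  - by move=> y [_ yU]; apply: contrapT => /cover.
apply: le_trans (measure_le_bigcup mS mZ tZ leZ) _.
by apply: le_measure; rewrite ?inE//; exact: measurableI.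
Qed.

(** This is D_n: the 0-based position 2n carries the index i = 2n + 1. *)
Definition upper_half n : set odo_space :=
  [set x | (n.*2.+1 <= x n.*2)%N].

Lemma measurable_upper_half n : measurable (upper_half n).
Proof. exact: (measurable_digit (fun a : 'I_(dmax n.*2).+1 => (n.*2.+1 <= a)%N)). Qed.

(** There are i digits from i to 2i - 1, each of mass 2^-i / i. *)
Lemma mu_upper_half n : mu (upper_half n) = (2 ^- n.*2.+1)%:E.
Proof.
set l := n.*2; have ol : odd l.+1 by rewrite /l /= odd_double.
pose B k : set 'I_(dmax k).+1 := [set a | k = l -> (l.+1 <= a)%N].
have -> : upper_half n = box l.+1 B.
  apply/seteqP; split => x /=; first by move=> h k _ kl; subst k.
  by move=> h; exact: (h l (ltnSn l)).
rewrite mu_box big_ord_recr/= big1 ?mul1r => [|k _]; last first.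
  rewrite -[RHS](factor_setT k); congr factor_measure; apply/seteqP; split => // a _ e.
  by have := ltn_ord k; rewrite [X in (X < _)%N]e ltnn.
congr EFin; rewrite /factor_measure.
transitivity (\sum_(j < (dmax l).+1 | (l.+1 <= j)%N) 2 ^- l.+1 / l.+1%:R : R).
  apply: eq_big => [j|j]; first by apply/idP/idP => [/set_mem/(_ erefl)|h]; rewrite ?inE.
  by move=> /set_mem/(_ erefl) h; rewrite /atom_mass ol ltnNge h.
transitivity (\sum_(l.+1 <= j < (dmax l).+1) 2 ^- l.+1 / l.+1%:R : R).
  by rewrite big_geq_mkord.
rewrite sumr_const_nat digit_max_oddE// -addnS addnK.
by rewrite -[LHS]mulr_natr mulfVK// pnatr_eq0.
Qed.

Lemma mu_upper_half_cvg : (mu (upper_half n) @[n --> \oo] --> 0)%E.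
Proof.
under eq_fun do rewrite mu_upper_half.
apply/fine_cvgP; split; first exact: nearW.
apply: (@squeeze_cvgr _ _ _ _ (cst 0) (fun n => 1 / 2 ^+ n)).
- near=> n; rewrite /= invr_ge0 exprn_ge0//= div1r lef_pV2 ?posrE ?exprn_gt0//.
  by rewrite ler_weXn2l ?ler1n// -addnn -addSn leq_addl.
- exact: cvg_cst.
- apply/cvgrPdist_lt => e e0; have := near_infty_natSinv_expn_lt (PosNum e0).
  apply: filterS => n; rewrite sub0r normrN ger0_norm// divr_ge0//.
Unshelve. all: by end_near. Qed.

End product_measure_facts.

(** * The shift by i N off D_n and its inverse *)

Section odometer_shift.
Local Notation shift n := (n.*2.+1 * odo_period n.*2)%N.

(** A digit at most i - 1 stays at most 2i - 1 after adding i, so the shift creates no carry. *)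
Lemma shift_no_overflow n (x : odo_space) : ~ upper_half n x ->
  (x n.*2 + n.*2.+1 <= digit_max n.*2.+1)%N.
Proof.
move=> /negP; rewrite -ltnNge ltnS => xn.
by rewrite [leqRHS]digit_max_oddE /= ?odd_double// addnC leq_add2l.
Qed.

Lemma odometer_shift n (x : odo_space) : ~ upper_half n x ->
  iter (shift n) odometer x = upd n.*2 (x n.*2 + n.*2.+1) x.
Proof. by move=> /shift_no_overflow/iter_odometer_digit. Qed.

Lemma odometer_shift_upper n (x : odo_space) : ~ upper_half n x ->
  upper_half n (iter (shift n) odometer x).
Proof.
move=> nx; rewrite odometer_shift// /upper_half /= updE ?leq_addl//.
exact: shift_no_overflow.
Qed.

(** The natural-number subtraction makes the map total: it is exact on [upper_half n] and truncates
    to 0 elsewhere. *)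
Definition shift_back n (x : odo_space) : odo_space :=
  upd n.*2 (x n.*2 - n.*2.+1)%N x.

Lemma measurable_shift_back n : measurable_fun setT (shift_back n).
Proof. exact: (@measurable_upd n.*2 (fun a => a - n.*2.+1)%N). Qed.

Lemma shift_backK n (x : odo_space) : ~ upper_half n x ->
  shift_back n (iter (shift n) odometer x) = x.
Proof.
move=> nx; rewrite odometer_shift// /shift_back upd_upd updE ?addnK ?upd_id//.
exact: shift_no_overflow.
Qed.

End odometer_shift.

(* The first conjunct is about the real space L^p, the second one about the
   complex space L^p. *)
Theorem claimB (R : realType) (mu : probability odo_space R)
    (mu_product : is_product_measure mu) (p : R) (p1 : (1 <= p%:E)%E) :
  (exists T : {linear LspaceType mu p1 -> LspaceType mu p1},
    [/\ is_composition_operator mu odometer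
          (fun u : LspaceType mu p1 => (u : odo_space -> R)) T,
        bounded_operator T
      & topologically_transitive T]) /\
  (exists T : {linear CLspace mu p1 -> CLspace mu p1},
    [/\ is_composition_operator mu odometer (@CLfun _ _ _ mu _ p1) T,
        bounded_operator T
      & topologically_transitive T]).
Proof.
have mo := measurable_odometer.
have c0 : 0 <= 8 :> R by [].
have mu8 := mu_odometer_le mu_product.
have muD := mu_upper_half_cvg mu_product.
split.
- exists (comp_op (p1 := p1) mo c0 mu8); split.
  + exact: comp_op_is_composition.
  + exact: comp_op_bounded.
  + exact: (comp_op_transitive mo c0 mu8 measurable_upper_half muD
      measurable_shift_back odometer_shift_upper shift_backK).
- exists (Ccomp_op (p1 := p1) mo c0 mu8); split.
  + exact: Ccomp_op_is_composition.
  + exact: Ccomp_op_bounded.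
  + exact: (Ccomp_op_transitive mo c0 mu8 measurable_upper_half muD
      measurable_shift_back odometer_shift_upper shift_backK).
Qed.
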